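(* Assume that $\mu \colon \mathcal{P}^2_o \to \mathbb{R}^2$ is a measurable valuation which is $\mathrm{VL}(2)$-covariant, i.e. $\mu(\phi P) = \phi\,\mu(P)$ for all $P \in \mathcal{P}^2_o$ and all $\phi \in \mathrm{VL}(2)$. Then there exists $k \in \mathbb{R}$ such that $\mu(P) = k\, m(P)$ for all $P \in \mathcal{P}^2_o$.
   Context: $\mathcal{P}^2_o$ denotes the set of convex polygons in $\mathbb{R}^2$ containing the origin in their interiors, with the Hausdorff metric topology; ''measurable'' refers to Borel $\sigma$-algebras. $\mathrm{VL}(2)$ is the group of linear maps of $\mathbb{R}^2$ with determinant $1$ or $-1$. A map $\mu$ on a family $\mathcal{S}$ of sets is a valuation if $\mu(K \cup L) + \mu(K \cap L) = \mu(K) + \mu(L)$ whenever $K, L, K\cup L, K \cap L \in \mathcal{S}$. The moment vector is $m(P) = \int_P x\,dx$. *)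

(* Defs.v *)
From HB Require Import structures.
From mathcomp Require Import all_boot all_order all_algebra.
From mathcomp Require Import all_classical all_reals all_analysis.
Set Implicit Arguments. Unset Strict Implicit. Unset Printing Implicit Defensive.
Import Order.TTheory GRing.Theory Num.Theory.
Local Open Scope classical_set_scope.
Local Open Scope ring_scope.

Section Defs.
Variable R : realType.
Local Notation pt := (R * R)%type.

Definition edist (x y : pt) : R :=
  Num.sqrt ((x.1 - y.1) ^+ 2 + (x.2 - y.2) ^+ 2).

Definition conv_hull (s : seq pt) : set pt :=
  [set x | exists w : 'I_(size s) -> R,
     (forall i, 0 <= w i) /\ \sum_i w i = 1 /\
     x.1 = \sum_i w i * (nth (0, 0) s i).1 /\
     x.2 = \sum_i w i * (nth (0, 0) s i).2].

Definition convex_polygon (P : set pt) : Prop :=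
  exists s : seq pt, P = conv_hull s.

Definition Po : set (set pt) :=
  [set P | convex_polygon P /\
     exists r : R, 0 < r /\ (forall x, edist x (0, 0) < r -> P x)].

Definition hausdorff_le (K L : set pt) (e : R) : Prop :=
  (forall x, K x -> exists y, L y /\ edist x y <= e) /\
  (forall y, L y -> exists x, K x /\ edist x y <= e).

Definition hausdorff_open (U : set (set pt)) : Prop :=
  U `<=` Po /\
  forall P, U P -> exists e : R, 0 < e /\
    forall Q, Po Q -> hausdorff_le P Q e -> U Q.

Definition Po_borel : set (set (set pt)) := <<s Po, hausdorff_open >>.

Definition Po_measurable (mu : set pt -> pt) : Prop :=
  forall B : set pt, measurable B -> Po_borel (Po `&` mu @^-1` B).

Definition is_valuation (mu : set pt -> pt) : Prop :=
  forall K L, Po K -> Po L -> Po (K `|` L) -> Po (K `&` L) ->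
    (mu (K `|` L)).1 + (mu (K `&` L)).1 = (mu K).1 + (mu L).1 /\
    (mu (K `|` L)).2 + (mu (K `&` L)).2 = (mu K).2 + (mu L).2.

Definition lin (A : 'M[R]_2) (x : pt) : pt :=
  (A 0 0 * x.1 + A 0 1 * x.2, A 1 0 * x.1 + A 1 1 * x.2).

Definition VL2 (A : 'M[R]_2) : Prop := \det A = 1 \/ \det A = -1.

Definition VL2_covariant (mu : set pt -> pt) : Prop :=
  forall P A, Po P -> VL2 A -> mu (lin A @` P) = lin A (mu P).

Definition leb2 := (@lebesgue_measure R \x @lebesgue_measure R)%E.

Definition moment (P : set pt) : pt :=
  (Rintegral leb2 P (fun x => x.1), Rintegral leb2 P (fun x => x.2)).

End Defs.

(* Main.v *)
(* A cap is a triangle w x y cut off from a polygon along [w, y].  By the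
   valuation property, the change of mu when a cap is added depends only on the
   cap; it is a covariant function C(w, x, y) satisfying a cocycle relation.

   Call a cap special if x - y is parallel to w and det(w, x) = 1.  On special
   caps with given w the relation makes C a cocycle of the group of shears fixing
   w.  Its free part is additive, hence linear by measurability, and C is
   determined on special caps by one constant, which is nonzero for the moment
   vector m.  After subtracting a multiple of m we may thus assume that C vanishes
   on special caps.

   For a cap (p, q, r) let w1, w2, w3 be the points completing its three sides
   to special caps.  The six points span an octahedron of whose faces six are
   special, up to reflection, so C(p, q, r) = - C(w1, w3, w2).  Reflecting the cap
   replaces each w by - w and gives C(p, q, r) = C(w1, w3, w2).  Hence C(p, q, r) = 0
   if the base of the cap is long enough for the octahedron to lie in a half-plane;
   other caps are subdivided into such ones.  So removing caps does not change mu,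
   and its value on any polygon is its value on a small centred square, that is 0. *)

From HB Require Import structures.
Require Import Defs.
From mathcomp Require Import all_boot all_order all_algebra.
From mathcomp Require Import all_classical all_reals all_analysis.
From mathcomp Require Import ring lra.
Import Order.TTheory GRing.Theory Num.Theory.
Import numFieldNormedType.Exports.
Set Implicit Arguments. Unset Strict Implicit. Unset Printing Implicit Defensive.
Local Open Scope classical_set_scope.
Local Open Scope ring_scope.

(** * Convex hulls *)

Section Hull.
Variable R : realType.
Local Notation pt := (R * R)%type.
Implicit Types (p q r x y z w v : pt) (s t : seq pt) (X : set pt).

(** A cap does not have the origin in its interior, so [mu] has no value on it; the value must be
    read off polygons that carry the cap. The carrier used is the triangle with vertices w, y and -e
    (w + y): it surrounds the origin for every e > 0, and for small e it fits into any polygon of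
    the family that contains w and y. The cocycle relation is available only for points in an open
    half-plane bounded by a line through the origin, because all determinants involved must be
    positive. This is the obstacle in the octahedron argument: its six points may spread too far.
    The argument needs one inequality between the base and a side, its reflection needs the other,
    and both hold when the base is long. On special caps the cocycle relation alone makes one
    coordinate linear and the other quadratic up to an additive function. Measurability enters as
    boundedness of that function near 0, obtained in the manner of Steinhaus, and a reflection of
    the cap fixes the remaining linear coefficient. The square gets the value 0 because it is
    invariant under x -> -x. *)

Definition mix (l : R) p q : pt :=
  (l * p.1 + (1 - l) * q.1, l * p.2 + (1 - l) * q.2).

Definition cvx_set X :=
  forall l p q, 0 <= l -> l <= 1 -> X p -> X q -> X (mix l p q).

Lemma pt_eq p q : p.1 = q.1 -> p.2 = q.2 -> p = q.
Proof. by case: p q => [a b] [c d] /= -> ->. Qed.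

Lemma hull_convex s : cvx_set (conv_hull s).
Proof.
move=> l p q l0 l1 [u [u0 [u1 [up1 up2]]]] [v [v0 [v1 [vq1 vq2]]]].
exists (fun i => l * u i + (1 - l) * v i); split.
  by move=> i; rewrite addr_ge0// mulr_ge0// subr_ge0.
split; first by rewrite big_split /= -!mulr_sumr u1 v1; ring.
by split; rewrite /mix /= ?up1 ?up2 ?vq1 ?vq2 !mulr_sumr -big_split /=;
  apply: eq_bigr => i _; ring.
Qed.

Lemma hull_mem s p : p \in s -> conv_hull s p.
Proof.
move=> ps; have i0 : (index p s < size s)%N by rewrite index_mem.
exists (fun i => (i == Ordinal i0)%:R); split; first by move=> i; rewrite ler0n.
have H (f : 'I_(size s) -> R) :
    \sum_i (i == Ordinal i0)%:R * f i = f (Ordinal i0).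
  rewrite (bigD1 (Ordinal i0)) //= eqxx mul1r big1 ?addr0// => i /negbTE ->.
  by rewrite mul0r.
split; last by rewrite !H /= nth_index.
by have := H (fun=> 1); under eq_bigr do rewrite mulr1.
Qed.

(** Induction on the list: the head has weight [1 - l], and the remaining weights are divided by
    their sum [l]. With [hull_mem] and [hull_convex] this lets almost all later proofs avoid
    weights. *)
Lemma hull_min s X : cvx_set X -> (forall p, p \in s -> X p) ->
  conv_hull s `<=` X.
Proof.
move=> cX; elim: s => [|a s IH] sX z [w [w0 [w1 [z1 z2]]]].
  by move: w1; rewrite big_ord0 => /eqP; rewrite eq_sym oner_eq0.
move: w1 z1 z2; rewrite /= !big_ord_recl /= => w1 z1 z2.
set w' := fun i : 'I_(size s) => w (lift ord0 i).
set l := \sum_i w' i.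
have Ea : w ord0 = 1 - l by rewrite -w1 addrK.
have l0 : 0 <= l by apply: sumr_ge0 => i _; exact: w0.
have Xa : X a by apply: sX; rewrite mem_head.
have [l00|l00] := eqVneq l 0.
  have w'0 i : w' i = 0.
    by apply: (psumr_eq0P (F := w') (P := xpredT)) => // j _; exact: w0.
  suff -> : z = a by [].
  by apply: pt_eq; rewrite ?z1 ?z2 Ea l00 subr0 mul1r big1 ?addr0// => i _;
    rewrite -/(w' i) w'0 mul0r.
have lp : 0 < l by rewrite lt_neqAle eq_sym l00.
set z' : pt := (\sum_i (w' i / l) * (nth (0,0) s i).1,
                \sum_i (w' i / l) * (nth (0,0) s i).2).
have Xz' : X z'.
  apply: IH; first by move=> p ps; apply: sX; rewrite in_cons ps orbT.
  exists (fun i => w' i / l); split; first by move=> i; rewrite divr_ge0// w0.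
  by split=> //; rewrite -mulr_suml divff.
suff -> : z = mix l z' a.
  by apply: cX => //; rewrite -subr_ge0 -Ea.
have H (f : 'I_(size s) -> R) : l * (\sum_i (w' i / l) * f i) = \sum_i w' i * f i.
  by rewrite mulr_sumr; apply: eq_bigr => i _; rewrite mulrCA mulrA divfK// mulrC.
by apply: pt_eq => /=; rewrite ?z1 ?z2 H Ea addrC.
Qed.

Lemma hull_sub s t : {subset s <= t} -> conv_hull s `<=` conv_hull t.
Proof. by move=> st; apply: hull_min => [|p /st]; [exact: hull_convex|exact: hull_mem]. Qed.

Lemma hull_subcons p s : conv_hull s `<=` conv_hull (p :: s).
Proof. by apply: hull_sub => a as_; rewrite inE as_ orbT. Qed.

Lemma hull_eq s t : s =i t -> conv_hull s = conv_hull t.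
Proof. by move=> st; apply/seteqP; split; apply: hull_sub => p; rewrite st. Qed.

Definition join X Y : set pt :=
  [set z | exists l p q, [/\ 0 <= l, l <= 1, X p, Y q & z = mix l p q]].

Lemma mix_combine (l m n : R) p q p' q' X Y : cvx_set X -> cvx_set Y ->
  0 <= l <= 1 -> 0 <= m <= 1 -> 0 <= n <= 1 -> X p -> X p' -> Y q -> Y q' ->
  join X Y (mix l (mix m p q) (mix n p' q')).
Proof.
move=> cX cY /andP[l0 l1] /andP[m0 m1] /andP[n0 n1] Xp Xp' Yq Yq'.
set k := l * m + (1 - l) * n.
have k0 : 0 <= k by rewrite addr_ge0 ?mulr_ge0// subr_ge0.
set k' := l * (1 - m) + (1 - l) * (1 - n).
have k'0 : 0 <= k' by rewrite addr_ge0 ?mulr_ge0 ?subr_ge0.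
have kk : k' = 1 - k by rewrite /k /k'; ring.
(* Normalising two weights fails when both vanish; then any point of [Z] serves. *)
have aux (a b : R) (Z : set pt) (u v : pt) : cvx_set Z -> Z u -> Z v -> 0 <= a -> 0 <= b ->
    exists2 z, Z z & (a + b) * z.1 = a * u.1 + b * v.1 /\ (a + b) * z.2 = a * u.2 + b * v.2.
  move=> cZ Zu Zv a0 b0; have [ab|ab] := eqVneq (a + b) 0.
    have : a = 0 by lra. have : b = 0 by lra. move=> -> ->; exists u => //.
    by rewrite !(add0r, mul0r).
  exists (mix (a / (a + b)) u v); last by rewrite /=; split; field.
  have abp : 0 < a + b by rewrite lt_neqAle eq_sym ab addr_ge0.
  by apply: cZ => //; [rewrite divr_ge0// ltW|rewrite ler_pdivrMr// mul1r lerDl].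
have [|||||x Xx [x1 x2]] := aux (l * m) ((1 - l) * n) X p p' => //;
  [by rewrite mulr_ge0|by rewrite mulr_ge0// subr_ge0|].
have [|||||y Yy [y1 y2]] := aux (l * (1 - m)) ((1 - l) * (1 - n)) Y q q' => //;
  [by rewrite mulr_ge0// subr_ge0|by rewrite mulr_ge0// subr_ge0|].
exists k, x, y; split=> //; first by lra.
by apply: pt_eq => /=; rewrite -kk /k /k' ?x1 ?y1 ?x2 ?y2; ring.
Qed.

Lemma join_convex X Y : cvx_set X -> cvx_set Y -> cvx_set (join X Y).
Proof.
move=> cX cY l p q l0 l1 [m [a [b [m0 m1 Xa Yb ->]]]] [n [c [d [n0 n1 Xc Yd ->]]]].
by apply: mix_combine => //; apply/andP.
Qed.

Lemma mix1 p q : mix 1 p q = p.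
Proof. by apply: pt_eq => /=; ring. Qed.
Lemma mix0 p q : mix 0 p q = q.
Proof. by apply: pt_eq => /=; ring. Qed.

Lemma mixxx l p : mix l p p = p.
Proof. by apply: pt_eq => /=; ring. Qed.

Lemma hull1 p : conv_hull [:: p] = [set p].
Proof.
apply/seteqP; split => [|z ->]; last by apply: hull_mem; rewrite mem_head.
by apply: hull_min => [l a b _ _ -> ->|a]; rewrite ?mixxx// inE => /eqP.
Qed.

Lemma hull_cat s t p q : p \in s -> q \in t ->
  conv_hull (s ++ t) = join (conv_hull s) (conv_hull t).
Proof.
move=> ps qt; apply/seteqP; split.
  apply: hull_min; first by apply: join_convex; exact: hull_convex.
  move=> a; rewrite mem_cat => /orP[as_|at_].
    exists 1, a, q; split => //; [exact: hull_mem|exact: hull_mem|by rewrite mix1].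
  exists 0, p, a; split => //; [exact: hull_mem|exact: hull_mem|by rewrite mix0].
move=> z [l [a [b [l0 l1 sa tb ->]]]]; apply: hull_convex => //.
  by apply: hull_sub sa => x; rewrite mem_cat => ->.
by apply: hull_sub tb => x; rewrite mem_cat => ->; rewrite orbT.
Qed.

Lemma hull_cons p t q : q \in t ->
  conv_hull (p :: t) = join [set p] (conv_hull t).
Proof. by move=> qt; rewrite -hull1 -(hull_cat (mem_head p [::]) qt). Qed.

Lemma convex_mix3 X (a b c : R) p q r : cvx_set X -> X p -> X q -> X r ->
  0 <= a -> 0 <= b -> 0 <= c -> a + b + c = 1 ->
  X (a * p.1 + b * q.1 + c * r.1, a * p.2 + b * q.2 + c * r.2).
Proof.
move=> cX Xp Xq Xr a0 b0 c0 abc.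
have [c1|c1] := eqVneq c 1.
  have -> : a = 0 by lra. have -> : b = 0 by lra.
  by rewrite c1 !mul0r !mul1r !add0r; case: r Xr.
have d0 : 0 < a + b by rewrite lt_neqAle addr_ge0// andbT; apply/eqP => ab; move/eqP: c1; apply;
    lra.
suff -> : (a * p.1 + b * q.1 + c * r.1, a * p.2 + b * q.2 + c * r.2) =
  mix (a + b) (mix (a / (a + b)) p q) r.
  apply: (cX) => //; [lra|lra|]; apply: (cX) => //; first by rewrite divr_ge0// ltW.
  by rewrite ler_pdivrMr// mul1r lerDl.
have -> : c = 1 - (a + b) by lra.
by apply: pt_eq => /=; field; rewrite gt_eqF.
Qed.

(** Twice the signed area of the triangle [a b c]; positive when [c] lies to the left of the line
    from [a] to [b]. *)
Definition orient a b c : R :=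
  (b.1 - a.1) * (c.2 - a.2) - (b.2 - a.2) * (c.1 - a.1).

Lemma orient_mix a b l p q : orient a b (mix l p q) = l * orient a b p + (1 - l) * orient a b q.
Proof. by rewrite /orient /=; ring. Qed.

Lemma orient_rot a b c : orient b c a = orient a b c. Proof. by rewrite /orient; ring. Qed.
Lemma orient_anti a b c : orient b a c = - orient a b c. Proof. by rewrite /orient; ring. Qed.

Lemma orient_ll a b : orient a a b = 0. Proof. by rewrite /orient; ring. Qed.
Lemma orient_lr a b : orient a b a = 0. Proof. by rewrite /orient; ring. Qed.
Lemma orient_rr a b : orient a b b = 0. Proof. by rewrite /orient; ring. Qed.

Lemma convex_halfplane a b : cvx_set [set z | 0 <= orient a b z].
Proof.
by move=> l p q l0 l1 /= Dp Dq; rewrite orient_mix addr_ge0// mulr_ge0// subr_ge0.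
Qed.

Lemma hull_halfplane a b s : (forall p, p \in s -> 0 <= orient a b p) ->
  forall z, conv_hull s z -> 0 <= orient a b z.
Proof. by move=> H; apply: (hull_min (@convex_halfplane a b)). Qed.

(** The three values of [orient] at [z], divided by [orient p q r], are the barycentric coordinates
    of [z]. *)
Lemma tri_mem X p q r z : cvx_set X -> X p -> X q -> X r ->
  0 < orient p q r -> 0 <= orient p q z -> 0 <= orient q r z -> 0 <= orient r p z -> X z.
Proof.
move=> cX Xp Xq Xr S0 z1 z2 z3.
have E : orient p q z + orient q r z + orient r p z = orient p q r by rewrite /orient; ring.
suff -> : z = (orient q r z / orient p q r * p.1 + orient r p z / orient p q r * q.1 +
    orient p q z / orient p q r * r.1,
               orient q r z / orient p q r * p.2 + orient r p z / orient p q r * q.2 +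
            orient p q z / orient p q r * r.2).
  apply: convex_mix3 => //; rewrite ?divr_ge0 ?(ltW S0)//.
  rewrite -!mulrDl (_ : _ + _ + _ = orient p q r) ?divff ?gt_eqF//.
  by rewrite -E; ring.
have S : orient p q r != 0 by rewrite gt_eqF.
by apply: pt_eq => /=; rewrite !(mulrAC _ (orient p q r)^-1) -!mulrDl;
  apply: (canRL (mulfK S)); rewrite /orient; ring.
Qed.

Lemma tri_mem_coef X p q r (a b c : R) : cvx_set X -> X p -> X q -> X r ->
  0 <= a -> 0 <= b -> 0 <= c -> a + b + c = 1 -> forall z,
  z.1 = a * p.1 + b * q.1 + c * r.1 -> z.2 = a * p.2 + b * q.2 + c * r.2 -> X z.
Proof.
move=> cX Xp Xq Xr a0 b0 c0 E z z1 z2.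
have -> : z = (z.1, z.2) by case: (z).
by rewrite z1 z2; apply: convex_mix3.
Qed.

End Hull.

(** * Caps *)

Section Caps.
Variable R : realType.
Local Notation pt := (R * R)%type.
Implicit Types (p q r x y z w v : pt) (s t : seq pt) (X : set pt).

Definition cross p q : R := p.1 * q.2 - p.2 * q.1.

Lemma crossC p q : cross q p = - cross p q. Proof. by rewrite /cross; ring. Qed.
Lemma crossxx p : cross p p = 0. Proof. by rewrite /cross; ring. Qed.

Lemma orient_cross p q r : orient p q r = cross p q + cross q r - cross p r.
Proof. by rewrite /orient /cross; ring. Qed.

(** A square about the origin replaces the disc, so that the interior condition becomes linear. *)
Lemma PoP (P : set pt) : Po P <-> convex_polygon P /\
  exists2 r, 0 < r & forall x, `|x.1| < r -> `|x.2| < r -> P x.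
Proof.
split=> [[pP [r [r0 rP]]]|[pP [r r0 rP]]]; split=> //.
  exists (r / 2) => [|x x1 x2]; first by rewrite divr_gt0.
  apply: rP; rewrite /Defs.edist /= !subr0.
  rewrite -(ltr_pXn2r (_ : (0 < 2)%N)) ?nnegrE ?sqrtr_ge0 ?(ltW r0)//.
  rewrite sqr_sqrtr ?addr_ge0 ?sqr_ge0//.
  rewrite -(real_normK (num_real x.1)) -(real_normK (num_real x.2)).
  have := normr_ge0 x.1; have := normr_ge0 x.2; nra.
exists r; split=> // x xr; apply: rP; apply: le_lt_trans xr;
  by rewrite /Defs.edist /= !subr0 -[leLHS]sqrtr_sqr ler_sqrt ?addr_ge0 ?sqr_ge0// ?lerDl ?lerDr sqr_ge0.
Qed.

Lemma Po_sup (K : set pt) t : Po K -> K `<=` conv_hull t -> Po (conv_hull t).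
Proof.
move=> /PoP[_ [r r0 rK]] KP; apply/PoP; split; first by exists t.
by exists r => // x x1 x2; apply: KP; apply: rK.
Qed.

Lemma affine_ball (c a b : R) : 0 < c ->
  exists2 r, 0 < r & forall x, `|x.1| < r -> `|x.2| < r -> 0 <= c + a * x.1 + b * x.2.
Proof.
move=> c0; have h : 0 < `|a| + `|b| + 1 by rewrite ltr_wpDl// addr_ge0.
exists (c / (`|a| + `|b| + 1)) => [|x]; first by rewrite divr_gt0.
rewrite !ltr_pdivlMr// => x1 x2.
have h1 : - (`|a| * `|x.1|) <= a * x.1 by rewrite -normrM lerNnormlW.
have h2 : - (`|b| * `|x.2|) <= b * x.2 by rewrite -normrM lerNnormlW.
have := normr_ge0 a; have := normr_ge0 b; have := normr_ge0 x.1; have := normr_ge0 x.2.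
nra.
Qed.

(** As [orient p q 0] is [cross p q], the origin lies strictly to the left of all three edges; by
    [affine_ball] a small square about it still does. *)
Lemma tri_Po p q r : 0 < cross p q -> 0 < cross q r -> 0 < cross r p ->
  Po (conv_hull [:: p; q; r]).
Proof.
move=> pq qr rp; apply/PoP; split; first by exists [:: p; q; r].
have aux a b : 0 < cross a b -> exists2 e : R, 0 < e &
    forall x, `|x.1| < e -> `|x.2| < e -> 0 <= orient a b x.
  move=> /(affine_ball (a.2 - b.2) (b.1 - a.1))[e e0 H].
  by exists e => // x x1 x2; have := H x x1 x2; congr (0 <= _); rewrite /orient /cross; ring.
have [e1 e10 H1] := aux _ _ pq; have [e2 e20 H2] := aux _ _ qr.
have [e3 e30 H3] := aux _ _ rp.
exists (Num.min e1 (Num.min e2 e3)); first by rewrite !lt_min e10 e20.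
move=> x; rewrite !lt_min => /andP[a1 /andP[a2 a3]] /andP[b1 /andP[b2 b3]].
apply: (@tri_mem _ _ p q r).
- exact: hull_convex.
- by apply: hull_mem; rewrite !inE eqxx.
- by apply: hull_mem; rewrite !inE eqxx ?orbT.
- by apply: hull_mem; rewrite !inE eqxx ?orbT.
- by rewrite orient_cross (_ : cross p r = - cross r p); [lra|rewrite /cross; ring].
- exact: H1.
- exact: H2.
- exact: H3.
Qed.

Definition cap_triple p q r :=
  [/\ 0 < cross p q, 0 < cross q r, 0 < cross p r & 0 <= orient p q r].

(** Barycentric coordinates as in [tri_mem]; the one of [q] vanishes, so [q] itself may lie outside
    [X]. *)
Lemma seg_mem X p q r z : cvx_set X -> X p -> X r -> 0 < orient p q r ->
  0 <= orient p q z -> 0 <= orient q r z -> orient r p z = 0 -> X z.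
Proof.
move=> cX Xp Xr S0 z1 z2 z3.
have E : orient p q z + orient q r z + orient r p z = orient p q r by rewrite /orient; ring.
have S : orient p q r != 0 by rewrite gt_eqF.
have -> : z = mix (orient q r z / orient p q r) p r.
  transitivity ((orient q r z / orient p q r * p.1 + orient r p z / orient p q r * q.1 +
      orient p q z / orient p q r * r.1,
               orient q r z / orient p q r * p.2 + orient r p z / orient p q r * q.2 +
            orient p q z / orient p q r * r.2) : pt).
    by apply: pt_eq => /=; rewrite !(mulrAC _ (orient p q r)^-1) -!mulrDl;
      apply: (canRL (mulfK S)); rewrite /orient; ring.
  have -> : orient p q z = orient p q r - orient q r z by rewrite -E z3; ring.
  by rewrite z3; apply: pt_eq => /=; field.
apply: cX => //; first by rewrite divr_ge0// ltW.
by rewrite ler_pdivrMr// mul1r -E z3 addr0 lerDr.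
Qed.

Lemma cap_triple_flat X p q r : cvx_set X -> X p -> X r -> cap_triple p q r ->
  orient p q r = 0 -> X q.
Proof.
move=> cX Xp Xr [pq qr pr _] S0.
have E : cross p q + cross q r = cross p r by move: S0; rewrite orient_cross; lra.
suff -> : q = mix (cross q r / cross p r) p r.
  by apply: cX => //; rewrite ?divr_ge0 ?(ltW _)// ltr_pdivrMr// mul1r -E ltrDr.
transitivity ((cross q r * p.1 + cross p q * r.1) / cross p r,
               (cross q r * p.2 + cross p q * r.2) / cross p r).
  by apply: pt_eq; apply: (canRL (mulfK _)); rewrite ?gt_eqF// /cross /=; ring.
have -> : cross p q = cross p r - cross q r by lra.
by apply: pt_eq => /=; field; rewrite gt_eqF.
Qed.

Lemma hull_absorb x t : conv_hull t x -> conv_hull (x :: t) = conv_hull t.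
Proof.
move=> tx; apply/seteqP; split; last by apply: hull_sub => z zt; rewrite inE zt orbT.
apply: hull_min; first exact: hull_convex.
by move=> z; rewrite inE => /orP[/eqP->//|]; exact: hull_mem.
Qed.

Lemma hull_inhab t z : conv_hull t z -> exists q, q \in t.
Proof.
case: t => [|q t]; last by exists q; rewrite mem_head.
by move=> [w [_ [/eqP]]]; rewrite big_ord0 eq_sym oner_eq0.
Qed.

(** A segment from [x] into the old hull stays between the lines [w x] and [x y], hence crosses the
    line [w y] within the chord, which belongs to the old hull. Up to the crossing it lies in the
    triangle, beyond it in the old hull. *)
Lemma hull_add w x y t : 0 < orient w x y -> conv_hull t w -> conv_hull t y ->
  (forall z, z \in t -> 0 <= orient w x z) -> (forall z, z \in t -> 0 <= orient x y z) ->
  conv_hull (x :: t) = conv_hull [:: x; w; y] `|` conv_hull t.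
Proof.
move=> S0 tw ty Hwx Hxy.
have [q qt] := hull_inhab tw.
apply/seteqP; split; last first.
  move=> z [|]; last by exact: hull_subcons.
  apply: hull_min; first exact: hull_convex.
  have ts a : conv_hull t a -> conv_hull (x :: t) a.
    by apply: hull_sub => b; rewrite inE => ->; rewrite orbT.
  move=> a; rewrite !inE => /or3P[] /eqP->; [|exact: ts|exact: ts].
  by apply: hull_mem; rewrite mem_head.
rewrite (hull_cons x qt) => z [l [a [z' [l0 l1 -> tz' zE]]]].
have {}Hwx := hull_halfplane Hwx; have {}Hxy := hull_halfplane Hxy.
have Dx : orient w y x = - orient w x y by rewrite /orient; ring.
have W0 : 0 <= orient w x z' := Hwx _ tz'.
have Y0 : 0 <= orient x y z' := Hxy _ tz'.
have DwxE k : orient w x (mix k x z') = (1 - k) * orient w x z' by rewrite /orient /=; ring.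
have DxyE k : orient x y (mix k x z') = (1 - k) * orient x y z' by rewrite /orient /=; ring.
have [Dz|Dz] := leP (orient w y z) 0.
  left; apply: (@tri_mem _ _ w x y) => //.
  - exact: hull_convex.
  - by apply: hull_mem; rewrite !inE eqxx ?orbT.
  - by apply: hull_mem; rewrite !inE eqxx ?orbT.
  - by apply: hull_mem; rewrite !inE eqxx ?orbT.
  - by rewrite zE DwxE mulr_ge0// subr_ge0.
  - by rewrite zE DxyE mulr_ge0// subr_ge0.
  - by rewrite orient_anti oppr_ge0.
right.
have d'0 : 0 < orient w y z'.
  move: Dz; rewrite zE orient_mix Dx; have := mulr_ge0 l0 (ltW S0).
  have [->|l1'] := eqVneq l 1; first by lra.
  by move=> h1 h2; rewrite -(pmulr_rgt0 _ (_ : 0 < 1 - l)); [lra|rewrite subr_gt0 lt_neqAle l1'].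
(* [mix m x z'] is the point where the segment from [x] to [z'] crosses the line [w y]. *)
set m := orient w y z' / (orient w y z' + orient w x y).
have dS : 0 < orient w y z' + orient w x y by rewrite addr_gt0.
have m0 : 0 < m by rewrite divr_gt0.
have m1 : m <= 1 by rewrite ler_pdivrMr// mul1r lerDl ltW.
have lm : l <= m.
  rewrite ler_pdivlMr//; move: Dz; rewrite zE orient_mix Dx; lra.
have tc : conv_hull t (mix m x z').
  apply: (@seg_mem _ w x y) => //; first exact: hull_convex.
  - by rewrite DwxE mulr_ge0// subr_ge0.
  - by rewrite DxyE mulr_ge0// subr_ge0.
  - by rewrite orient_anti orient_mix Dx /m; field; rewrite gt_eqF.
have -> : z = mix (l / m) (mix m x z') z'.
  by rewrite zE; apply: pt_eq => /=; field; rewrite gt_eqF.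
apply: hull_convex => //; first by rewrite divr_ge0// ltW.
by rewrite ler_pdivrMr// mul1r.
Qed.

(** With this point as [v], both [cross r v] and [cross v p] equal [e * cross p r], so the triangle
    [p r v] surrounds the origin. *)
Definition opp_apex (e : R) p r : pt := (- e * (p.1 + r.1), - e * (p.2 + r.2)).

(** The third vertex does not lie beyond the lines [p q] and [q r], so that adding [q] to the
    carrier triangle adds just the cap. *)
Definition valid e p q r := [/\ 0 < e, 0 <= orient p q (opp_apex e p r) & 0 <=
    orient q r (opp_apex e p r)].

(** [orient a b] is affine along the ray of third vertices and equals [cross a b] at the origin. *)
Lemma valid_le e e' p q r : cap_triple p q r -> 0 < e -> e <= e' -> valid e' p q r -> valid e p q r.
Proof.
move=> [pq qr pr S0] e0 ee' [e'0 h1 h2].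
have E a b : orient a b (opp_apex e p r) = (1 - e / e') * cross a b +
    e / e' * orient a b (opp_apex e' p r).
  by rewrite /orient /cross /=; field; rewrite gt_eqF.
have h0 : 0 <= e / e' by rewrite divr_ge0// ltW.
have h3 : 0 <= 1 - e / e' by rewrite subr_ge0 ler_pdivrMr ?mul1r.
by split; rewrite // E addr_ge0// mulr_ge0// ltW.
Qed.

(* Any small enough value works, by [cap_valid]; one that depends only on cross
   products makes [cap_val] visibly covariant. *)
Definition cap_eps p q r : R := cross p q * cross q r / (cross p q + cross q r) ^+ 2.

(** With a = [cross p q] and b = [cross q r], both conditions follow from e b <= a and e a <= b,
    which hold for e = a b / (a + b)^2. *)
Lemma valid_cap_eps p q r : cap_triple p q r -> valid (cap_eps p q r) p q r.
Proof.
move=> [pq qr pr S0]; have s0 : 0 < cross p q + cross q r by rewrite addr_gt0.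
have e0 : 0 < cap_eps p q r by rewrite divr_gt0 ?mulr_gt0 ?exprn_gt0.
have E1 : orient p q (opp_apex (cap_eps p q r) p r) =
    cross p q - cap_eps p q r * (cross q r - cross p q - cross p r).
  by rewrite /orient /cross /=; ring.
have E2 : orient q r (opp_apex (cap_eps p q r) p r) =
    cross q r - cap_eps p q r * (cross p q - cross q r - cross p r).
  by rewrite /orient /cross /=; ring.
have e1 : cap_eps p q r * (cross p q + cross q r) ^+ 2 = cross p q * cross q r.
  by rewrite /cap_eps divfK// gt_eqF// exprn_gt0.
have a1 : cap_eps p q r * cross q r <= cross p q.
  rewrite -(ler_pM2r (exprn_gt0 2 s0)) mulrAC e1.
  have := mulr_gt0 pq (mulr_gt0 pq qr); have := mulr_gt0 pq (mulr_gt0 pq pq).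
  by rewrite expr2; lra.
have a2 : cap_eps p q r * cross p q <= cross q r.
  rewrite -(ler_pM2r (exprn_gt0 2 s0)) mulrAC e1.
  have := mulr_gt0 qr (mulr_gt0 pq qr); have := mulr_gt0 qr (mulr_gt0 qr qr).
  by rewrite expr2; lra.
have := mulr_gt0 e0 pr; have := mulr_gt0 e0 pq; have := mulr_gt0 e0 qr.
move=> g1 g2 g3; split=> //; rewrite ?E1 ?E2; lra.
Qed.

(** * The value of a cap is independent of its carrier *)

Variable mu : set pt -> pt.
Hypothesis mu_val : is_valuation mu.

Definition cap_val p q r : pt :=
  mu (conv_hull [:: q; p; r; opp_apex (cap_eps p q r) p r]) - mu (conv_hull [:: p; r;
      opp_apex (cap_eps p q r) p r]).

Lemma valE K L : Po K -> Po L -> Po (K `|` L) -> Po (K `&` L) ->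
  mu (K `|` L) + mu (K `&` L) = mu K + mu L.
Proof. by move=> k l kl ki; apply: pt_eq; case: (mu_val k l kl ki). Qed.

Lemma tri_opp_apex_Po e p r : 0 < cross p r -> 0 < e -> Po (conv_hull [:: p; r; opp_apex e p r]).
Proof.
move=> pr e0; have h := mulr_gt0 e0 pr; apply: tri_Po => //.
  by rewrite (_ : cross _ _ = e * cross p r)// /cross /=; ring.
by rewrite (_ : cross _ _ = e * cross p r)// /cross /=; ring.
Qed.

(** Apply the valuation property to the carrier triangle with [x] added and to the hull of [t]. The
    line [w y] separates the cap from [t], so they share only the chord; hence the intersection is
    the carrier triangle, and the union is the hull of [x :: t]. *)
Lemma cap_core w x y t e : Po (conv_hull t) -> cap_triple w x y ->
  conv_hull t w -> conv_hull t y ->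
  (forall z, z \in t -> [/\ 0 <= orient w x z, 0 <= orient x y z & 0 <= orient w y z]) ->
  valid e w x y -> conv_hull t (opp_apex e w y) ->
  mu (conv_hull (x :: t)) - mu (conv_hull t) =
  mu (conv_hull [:: x; w; y; opp_apex e w y]) - mu (conv_hull [:: w; y; opp_apex e w y]).
Proof.
move=> Pt cap tw ty H [e0 v1 v2] tv.
have [wx xy wy] := cap; rewrite le_eqVlt => /predU1P[/esym S0|S0].
  rewrite (@hull_absorb x t) ?(@hull_absorb x [:: w; y; _]) ?subrr//;
      apply: (cap_triple_flat _ _ _ cap) => //;
    first [exact: hull_convex | by apply: hull_mem; rewrite !inE eqxx ?orbT].
set t' := [:: w; y; opp_apex e w y].
have t'w : conv_hull t' w by apply: hull_mem; rewrite !inE eqxx ?orbT.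
have t'y : conv_hull t' y by apply: hull_mem; rewrite !inE eqxx ?orbT.
have Pt' : Po (conv_hull t') by exact: tri_opp_apex_Po.
have t't : conv_hull t' `<=` conv_hull t.
  apply: hull_min; first exact: hull_convex.
  by move=> z; rewrite !inE => /or3P[] /eqP->.
have E1 : conv_hull (x :: t) = conv_hull [:: x; w; y] `|` conv_hull t.
  by apply: hull_add => // z /H[].
have E2 : conv_hull (x :: t') = conv_hull [:: x; w; y] `|` conv_hull t'.
  apply: hull_add => // z; rewrite !inE => /or3P[] /eqP-> //;
      rewrite ?orient_lr ?orient_rr ?(ltW S0)//.
  by rewrite orient_rot ltW.
have Ht z : conv_hull t z -> 0 <= orient w y z by apply: hull_halfplane => a /H[].
have EU : conv_hull (x :: t') `|` conv_hull t = conv_hull (x :: t).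
  by rewrite E1 E2 -setUA ((setUidPr _ _).2 t't).
have EI : conv_hull (x :: t') `&` conv_hull t = conv_hull t'.
  rewrite E2 setIUl ((setIidPl _ _).2 t't); apply/setUidPr => z [Tz tz].
  apply: (@seg_mem _ w x y) => //; first exact: hull_convex.
  - by apply: hull_halfplane Tz => a; rewrite !inE => /or3P[] /eqP->;
      rewrite ?orient_lr ?orient_rr ?(ltW S0).
  - by apply: hull_halfplane Tz => a; rewrite !inE => /or3P[] /eqP->;
      rewrite ?orient_lr ?orient_rr// orient_rot ltW.
  - apply/eqP; rewrite eq_le; apply/andP; split; first by rewrite orient_anti oppr_le0 Ht.
    by apply: hull_halfplane Tz => a; rewrite !inE => /or3P[] /eqP->;
        rewrite ?orient_lr ?orient_rr// -orient_rot ltW.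
have Pxt : Po (conv_hull (x :: t)).
  by apply: Po_sup Pt _; exact: hull_subcons.
have Pxt' : Po (conv_hull (x :: t')).
  by apply: Po_sup Pt' _; exact: hull_subcons.
have := valE Pxt' Pt; rewrite EU EI => /(_ Pxt Pt') HH.
apply/eqP; rewrite subr_eq addrAC eq_sym subr_eq; apply/eqP.
by rewrite HH.
Qed.

(** Of two carrier triangles on the same chord the smaller lies in the larger, so [cap_core]
    compares them. *)
Lemma cap_valid e w x y : cap_triple w x y -> valid e w x y ->
  mu (conv_hull [:: x; w; y; opp_apex e w y]) - mu (conv_hull [:: w; y; opp_apex e w y]) =
      cap_val w x y.
Proof.
move=> cap; have ve := valid_cap_eps cap; rewrite /cap_val.
have H a b : valid a w x y -> valid b w x y -> a <= b ->
  mu (conv_hull [:: x; w; y; opp_apex a w y]) - mu (conv_hull [:: w; y; opp_apex a w y]) =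
  mu (conv_hull [:: x; w; y; opp_apex b w y]) - mu (conv_hull [:: w; y; opp_apex b w y]).
  move=> va [b0 vb1 vb2] ab; have [a0 va1 va2] := va; have [wx xy wy S0] := cap.
  apply/esym/cap_core => //.
  - exact: tri_opp_apex_Po.
  - by apply: hull_mem; rewrite !inE eqxx ?orbT.
  - by apply: hull_mem; rewrite !inE eqxx ?orbT.
  - move=> z; rewrite !inE => /or3P[] /eqP->; split=> //.
    + by rewrite orient_lr.
    + by rewrite orient_rot.
    + by rewrite orient_lr.
    + by rewrite orient_rr.
    + by rewrite orient_rr.
    + rewrite (_ : orient _ _ _ = (1 + b + b) * cross w y).
        by rewrite mulr_ge0//; [lra|exact: ltW].
      by rewrite /orient /cross /=; ring.
  - have h0 : 0 < 1 + 2 * b by lra.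
    have c1 : 0 <= (b - a) / (1 + 2 * b) by rewrite divr_ge0 ?subr_ge0// ltW.
    have c2 : 0 <= (1 + 2 * a) / (1 + 2 * b) by rewrite divr_ge0//; lra.
    (* Barycentric coordinates of the smaller third vertex in the larger triangle. *)
    apply: (@tri_mem_coef _ _ w y (opp_apex b w y) ((b - a) / (1 + 2 * b)) ((b - a) / (1 +
        2 * b)) ((1 + 2 * a) / (1 + 2 * b))) => //.
    + exact: hull_convex.
    + by apply: hull_mem; rewrite !inE eqxx ?orbT.
    + by apply: hull_mem; rewrite !inE eqxx ?orbT.
    + by apply: hull_mem; rewrite !inE eqxx ?orbT.
    + by field; rewrite gt_eqF.
    + by rewrite /=; field; rewrite gt_eqF.
    + by rewrite /=; field; rewrite gt_eqF.
by move=> va; have [ab|/ltW ab] := leP e (cap_eps w x y); [|apply/esym]; apply: H.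
Qed.

(** The third vertex is moved towards the origin until it lies in a square contained in the hull of
    [t]; then [cap_core] applies. *)
Lemma cap_add w x y t : Po (conv_hull t) -> cap_triple w x y ->
  conv_hull t w -> conv_hull t y ->
  (forall z, z \in t -> [/\ 0 <= orient w x z, 0 <= orient x y z & 0 <= orient w y z]) ->
  mu (conv_hull (x :: t)) = mu (conv_hull t) + cap_val w x y.
Proof.
move=> Pt cap tw ty H.
have [_ [r r0 Hr]] := (PoP _).1 Pt.
(* A positive bound for the coordinates of [w + y]; with e at most r / (2 k) the third vertex stays
   within r of the origin in each coordinate. *)
set k := 1 + `|w.1 + y.1| + `|w.2 + y.2|.
have k0 : 0 < k.
  by rewrite /k; have := normr_ge0 (w.1 + y.1); have := normr_ge0 (w.2 + y.2); lra.
have ve := valid_cap_eps cap; have [e0 _ _] := ve.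
set e := Num.min (cap_eps w x y) (r / k / 2).
have rk : 0 < r / k / 2 by rewrite !divr_gt0.
have e'0 : 0 < e by rewrite lt_min e0.
have ve' : valid e w x y by apply: valid_le ve => //; rewrite ge_min lexx.
have ek : e * k < r.
  rewrite (@le_lt_trans _ _ (r / 2))//; last by rewrite ltr_pdivrMr//; lra.
  by rewrite (_ : r / 2 = r / k / 2 * k) ?ler_pM2r ?ge_min ?lexx ?orbT//; field; rewrite gt_eqF.
have tv : conv_hull t (opp_apex e w y).
  apply: Hr; rewrite /= mulNr normrN normrM (gtr0_norm e'0) (le_lt_trans _ ek)// ler_pM2l// /k.
    by rewrite addrAC lerDr addr_ge0.
  by rewrite lerDr addr_ge0.
by rewrite -(cap_valid cap ve') -(cap_core Pt cap tw ty H ve' tv) addrC subrK.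
Qed.

End Caps.

(** * Covariance and the cocycle relation *)

Section Covariance.
Variable R : realType.
Local Notation pt := (R * R)%type.
Implicit Types (p q r x y z w v : pt) (s t : seq pt) (X : set pt).

(** Explicit entries in place of a matrix keep all identities within reach of [ring]. *)
Definition lin2 (a b c d : R) x : pt := (a * x.1 + b * x.2, c * x.1 + d * x.2).

Lemma lin_lin2 (A : 'M[R]_2) : lin A = lin2 (A 0 0) (A 0 1) (A 1 0) (A 1 1).
Proof. by []. Qed.

Lemma cross_lin2 a b c d p q : cross (lin2 a b c d p) (lin2 a b c d q) =
    (a * d - b * c) * cross p q.
Proof. by rewrite /cross /lin2 /=; ring. Qed.

Lemma orient_lin2 a b c d p q r :
  orient (lin2 a b c d p) (lin2 a b c d q) (lin2 a b c d r) = (a * d - b * c) * orient p q r.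
Proof. by rewrite /orient /lin2 /=; ring. Qed.

Lemma lin2_mix a b c d l p q : lin2 a b c d (mix l p q) = mix l (lin2 a b c d p) (lin2 a b c d q).
Proof. by apply: pt_eq => /=; ring. Qed.

Lemma lin2B a b c d p q : lin2 a b c d (p - q) = lin2 a b c d p - lin2 a b c d q.
Proof. by apply: pt_eq => /=; ring. Qed.

Lemma lin2_opp_apex a b c d e p r : lin2 a b c d (opp_apex e p r) =
    opp_apex e (lin2 a b c d p) (lin2 a b c d r).
Proof. by apply: pt_eq => /=; ring. Qed.

Lemma lin2_hull a b c d s : lin2 a b c d @` conv_hull s = conv_hull (map (lin2 a b c d) s).
Proof.
apply/seteqP; split.
  move=> _ [z sz <-]; pose X := [set z | conv_hull (map (lin2 a b c d) s) (lin2 a b c d z)].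
  apply: (@hull_min _ s X) z sz => [l p q l0 l1 Xp Xq|p ps].
    by rewrite /X /= lin2_mix; apply: hull_convex.
  by apply: hull_mem; rewrite map_f.
apply: hull_min => [l _ _ l0 l1 [p sp <-] [q sq <-]|_ /mapP[p ps ->]].
  by exists (mix l p q); rewrite ?lin2_mix//; apply: hull_convex.
by exists p => //; apply: hull_mem.
Qed.

Lemma det_mx2 (A : 'M[R]_2) : \det A = A 0 0 * A 1 1 - A 0 1 * A 1 0.
Proof.
rewrite (expand_det_row _ ord0) big_ord_recl big_ord1 /cofactor !det_mx11 !mxE /=.
rewrite expr0 mul1r expr1 mulN1r mulrN.
have e0 : ord0 = 0 :> 'I_2 by apply: val_inj.
have e1 : lift ord0 0 = 1 :> 'I_2 by apply: val_inj.
have e2 : lift 1 0 = 0 :> 'I_2 by apply: val_inj.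
by rewrite !e1 !e2 !e0.
Qed.

Definition covariant (mu : set pt -> pt) := forall a b c d P,
  a * d - b * c = 1 \/ a * d - b * c = -1 -> Po P -> mu (lin2 a b c d @` P) = lin2 a b c d (mu P).

Lemma VL2_covariantP (mu : set pt -> pt) : VL2_covariant mu -> covariant mu.
Proof.
move=> H a b c d P dE PP.
pose A : 'M[R]_2 := \matrix_(i, j)
  (if i == 0 then if j == 0 then a else b else if j == 0 then c else d).
have -> : lin2 a b c d = lin A by rewrite lin_lin2 /A !mxE.
by apply: H => //; rewrite /VL2 det_mx2 /A !mxE.
Qed.

Variable mu : set pt -> pt.
Hypotheses (mu_val : is_valuation mu) (mu_cov : covariant mu).
Local Notation C := (cap_val mu).

Lemma cap_Po p q r : cap_triple p q r -> Po (conv_hull [:: p; r; opp_apex (cap_eps p q r) p r])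
  /\ Po (conv_hull [:: q; p; r; opp_apex (cap_eps p q r) p r]).
Proof.
move=> cap; have [e0 _ _] := valid_cap_eps cap; have [_ _ pr _] := cap.
have P1 := tri_opp_apex_Po pr e0; split => //.
by apply: Po_sup P1 _; exact: hull_subcons.
Qed.

Lemma C_cov a b c d p q r : a * d - b * c = 1 -> cap_triple p q r ->
  C (lin2 a b c d p) (lin2 a b c d q) (lin2 a b c d r) = lin2 a b c d (C p q r).
Proof.
move=> d1 cap; have [P1 P2] := cap_Po cap.
rewrite /cap_val lin2B -!mu_cov ?lin2_hull /= ?lin2_opp_apex; try by [|left].
by rewrite /cap_eps !cross_lin2 d1 !mul1r.
Qed.

(** A map of determinant -1 reverses orientation, so the ends of the base change places. *)
Lemma C_refl a b c d p q r : a * d - b * c = -1 -> cap_triple p q r ->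
  C (lin2 a b c d r) (lin2 a b c d q) (lin2 a b c d p) = lin2 a b c d (C p q r).
Proof.
move=> d1 cap; have [P1 P2] := cap_Po cap.
rewrite /cap_val lin2B -!mu_cov ?lin2_hull /= ?lin2_opp_apex; try by [|right].
have -> : cap_eps (lin2 a b c d r) (lin2 a b c d q) (lin2 a b c d p) = cap_eps p q r.
  rewrite /cap_eps !cross_lin2 d1 !mulN1r.
  by rewrite (crossC q r) (crossC p q) !opprK [cross q r * _]mulrC [cross q r + _]addrC.
have -> : opp_apex (cap_eps p q r) (lin2 a b c d r) (lin2 a b c d p) =
    opp_apex (cap_eps p q r) (lin2 a b c d p) (lin2 a b c d r).
  by apply: pt_eq => /=; ring.
congr (mu _ - mu _); apply: hull_eq => z; rewrite !inE; first by congr orb; rewrite orbCA.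
by rewrite orbCA.
Qed.

Lemma C_flat p q r : cap_triple p q r -> orient p q r = 0 -> C p q r = 0.
Proof.
move=> cap D0; rewrite /cap_val hull_absorb ?subrr//.
by apply: cap_triple_flat cap D0; first [exact: hull_convex | by apply: hull_mem;
    rewrite !inE eqxx ?orbT].
Qed.

(** At e = 0 each [orient] is the positive number [cross], and it is affine in e; finitely many such
    conditions hold for a common range of e. *)
Lemma small_opp_apex (l : seq (pt * pt)) p r : (forall xy, xy \in l -> 0 < cross xy.1 xy.2) ->
  exists2 e0, 0 < e0 & forall e, 0 < e -> e <= e0 ->
    forall xy, xy \in l -> 0 <= orient xy.1 xy.2 (opp_apex e p r).
Proof.
elim: l => [|[x y] l IH] H; first by exists 1.
have [|e1 e10 H1] := IH; first by move=> xy xyl; apply: H; rewrite inE xyl orbT.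
have xy0 : 0 < cross x y by apply: (H (x, y)); rewrite mem_head.
set M := cross x y - orient x y (opp_apex 1 p r).
have M0 : 0 < `|M| + 1 by have := normr_ge0 M; lra.
exists (Num.min e1 (cross x y / (`|M| + 1))); first by rewrite lt_min e10 divr_gt0.
move=> e e0; rewrite le_min => /andP[ee1]; rewrite ler_pdivlMr// => ee2 xy.
rewrite inE => /orP[/eqP->|]; last exact: H1.
rewrite (_ : orient _ _ _ = cross x y - e * M) /=.
  have := ler_norm M; rewrite -(ler_pM2l e0); lra.
by rewrite /M /orient /cross /=; ring.
Qed.

(** Both sides are the change of [mu] from a carrier triangle [p s v] to the hull of [p q r s v]: on
    the left [r] is added before [q], on the right [q] before [r]. The four caps are the faces of
    the tetrahedron [p q r s]. *)
Lemma C_cocycle p q r (s : pt) : cap_triple p q r -> cap_triple p r s -> cap_triple q r s ->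
    cap_triple p q s ->
  C p q r + C p r s = C q r s + C p q s.
Proof.
move=> cpqr cprs cqrs cpqs.
have [pq qr pr S1] := cpqr; have [_ rs ps S2] := cprs; have [_ _ qs S3] := cqrs;
    have [_ _ _ S4] := cpqs.
have [|e e0 /(_ e e0 (lexx _)) H] := @small_opp_apex [:: (p, q); (q, r); (p, r); (r, s); (p, s);
    (q, s)] p s.
  by move=> [x y]; rewrite !inE => /or4P[/eqP[-> ->]|/eqP[-> ->]|/eqP[-> ->]|/or3P[]/eqP[-> ->]].
have Hv x y : (x, y) \in [:: (p, q); (q, r); (p, r); (r, s); (p, s); (q, s)] ->
  0 <= orient x y (opp_apex e p s) by move=> /H.
have Hpq : 0 <= orient p q (opp_apex e p s) by apply: Hv; rewrite !inE eqxx ?orbT.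
have Hqr : 0 <= orient q r (opp_apex e p s) by apply: Hv; rewrite !inE eqxx ?orbT.
have Hpr : 0 <= orient p r (opp_apex e p s) by apply: Hv; rewrite !inE eqxx ?orbT.
have Hrs : 0 <= orient r s (opp_apex e p s) by apply: Hv; rewrite !inE eqxx ?orbT.
have Hps : 0 <= orient p s (opp_apex e p s) by apply: Hv; rewrite !inE eqxx ?orbT.
have Hqs : 0 <= orient q s (opp_apex e p s) by apply: Hv; rewrite !inE eqxx ?orbT.
set v := opp_apex e p s in Hpq Hqr Hpr Hrs Hps Hqs.
have P0 := tri_opp_apex_Po ps e0; rewrite -/v in P0.
have Pq : Po (conv_hull [:: q; p; s; v]) by apply: Po_sup P0 _; exact: hull_subcons.
have Pr : Po (conv_hull [:: r; p; s; v]) by apply: Po_sup P0 _; exact: hull_subcons.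
have S1' : 0 <= orient q r p by rewrite orient_rot.
have S2' : 0 <= orient r s p by rewrite orient_rot.
have S3' : 0 <= orient r s q by rewrite orient_rot.
have S4' : 0 <= orient q s p by rewrite orient_rot.
have E1 : mu (conv_hull [:: q; p; s; v]) = mu (conv_hull [:: p; s; v]) + C p q s.
  apply: cap_add => //; try by apply: hull_mem; rewrite !inE eqxx ?orbT.
  by move=> z; rewrite !inE => /or3P[] /eqP->; split; rewrite ?orient_lr ?orient_rr ?orient_ll.
have E2 : mu (conv_hull [:: r; p; s; v]) = mu (conv_hull [:: p; s; v]) + C p r s.
  apply: cap_add => //; try by apply: hull_mem; rewrite !inE eqxx ?orbT.
  by move=> z; rewrite !inE => /or3P[] /eqP->; split; rewrite ?orient_lr ?orient_rr ?orient_ll.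
have E3 : mu (conv_hull [:: r; q; p; s; v]) = mu (conv_hull [:: q; p; s; v]) + C q r s.
  apply: cap_add => //; try by apply: hull_mem; rewrite !inE eqxx ?orbT.
  by move=> z; rewrite !inE => /or4P[] /eqP->; split; rewrite ?orient_lr ?orient_rr ?orient_ll.
have E4 : mu (conv_hull [:: q; r; p; s; v]) = mu (conv_hull [:: r; p; s; v]) + C p q r.
  apply: cap_add => //; try by apply: hull_mem; rewrite !inE eqxx ?orbT.
  by move=> z; rewrite !inE => /or4P[] /eqP->; split;
      rewrite ?orient_lr ?orient_rr ?orient_ll// -orient_rot.
have E5 : conv_hull [:: q; r; p; s; v] = conv_hull [:: r; q; p; s; v].
  by apply: hull_eq => z; rewrite !inE orbCA.
move: E4; rewrite E5 E3 E2 E1.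
move: (mu _) (C p q r) (C p r s) (C q r s) (C p q s) => m c1 c2 c3 c4.
by rewrite -!addrA => /addrI; rewrite addrC [c2 + _]addrC => ->.
Qed.

End Covariance.

(** * The octahedron argument *)

Section Octahedron.
Variable R : realType.
Local Notation pt := (R * R)%type.
Implicit Types (p q r x y z w v : pt) (X : set pt).
Variable mu : set pt -> pt.
Hypotheses (mu_val : is_valuation mu) (mu_cov : covariant mu).
Local Notation C := (cap_val mu).
Local Notation e1 := ((1, 0) : pt).
Local Notation e2 := ((0, 1) : pt).
Hypothesis C_unit : forall t : R, 0 < t -> C e1 e2 (- t, 1) = 0.

Lemma cap_triple_unit (t : R) : 0 < t -> cap_triple e1 e2 (- t, 1).
Proof. by move=> t0; split; rewrite /orient /cross /=; lra. Qed.

Lemma lin20 (a b c d : R) : lin2 a b c d 0 = 0.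
Proof. by apply: pt_eq => /=; ring. Qed.

(** The linear map taking [e1] to [w] and [e2] to [x] has determinant 1 and takes [(- t, 1)] to
    [y]. *)
Lemma C_special1 w x y t : 0 < t -> cross w x = 1 ->
  y = (x.1 - t * w.1, x.2 - t * w.2) -> C w x y = 0.
Proof.
move=> t0 wx ->; have := C_cov (a := w.1) (b := x.1) (c := w.2) (d :=
    x.2) mu_cov _ (cap_triple_unit t0).
rewrite C_unit// lin20 => <-; last by rewrite -wx /cross; ring.
by congr (cap_val _ _ _ _); apply: pt_eq => /=; ring.
Qed.

(** The mirror image of [C_special1]: [e1] goes to [y] and [e2] to [x] with determinant -1, and
    [(- t, 1)] goes to [w]. *)
Lemma C_special2 w x y t : 0 < t -> cross x y = 1 ->
  w = (x.1 - t * y.1, x.2 - t * y.2) -> C w x y = 0.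
Proof.
move=> t0 xy ->; have := C_refl (a := y.1) (b := x.1) (c := y.2) (d :=
    x.2) mu_cov _ (cap_triple_unit t0).
rewrite C_unit// lin20 => <-; last by rewrite -xy /cross; ring.
by congr (cap_val _ _ _ _); apply: pt_eq => /=; ring.
Qed.

Lemma small_pos (l : seq (R * R)) : (forall ab, ab \in l -> 0 < ab.1) ->
  exists2 e0 : R, 0 < e0 & forall e, 0 < e -> e <= e0 ->
    forall ab, ab \in l -> 0 < ab.1 + e * ab.2.
Proof.
elim: l => [|[a b] l IH] H; first by exists 1.
have [|e3 e30 H3] := IH; first by move=> ab abl; apply: H; rewrite inE abl orbT.
have a0 : 0 < a by apply: (H (a, b)); rewrite mem_head.
have b0 : 0 < `|b| + 1 by have := normr_ge0 b; lra.
exists (Num.min e3 (a / (`|b| + 1))); first by rewrite lt_min e30 divr_gt0.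
move=> e e0; rewrite le_min => /andP[ee1]; rewrite ler_pdivlMr// => ee2 ab.
rewrite inE => /orP[/eqP->|]; last exact: H3.
by rewrite /=; have := ler_norm (- b); rewrite normrN -(ler_pM2l e0); lra.
Qed.

Definition scaled_diff (k : R) p q : pt := (k * (p.1 - q.1), k * (p.2 - q.2)).

Lemma cross_scl k p q x : cross (scaled_diff k p q) x = k * (cross p x - cross q x).
Proof. by rewrite /cross /=; ring. Qed.

Lemma cross_scr k p q x : cross x (scaled_diff k p q) = k * (cross x p - cross x q).
Proof. by rewrite /cross /=; ring. Qed.

(* z lies angularly just before a and very close to the origin. *)
Lemma base_point (a b : pt) (l : seq pt) (es : seq (pt * pt)) :
  0 < cross a b -> (forall x, x \in l -> 0 < cross a x) ->
  (forall xy, xy \in es -> [/\ xy.1 \in a :: l, xy.2 \in a :: l & 0 < cross xy.1 xy.2]) ->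
  exists z, forall xy, xy \in es -> cap_triple z xy.1 xy.2.
Proof.
move=> ab al Hes.
have [|k k0 /(_ k k0 (lexx _)) Hk] := @small_pos [seq (cross a x, - cross b x) | x <- l].
  by move=> _ /mapP[x xl ->]; exact: al.
pose z0 : pt := (a.1 - k * b.1, a.2 - k * b.2).
have z0l x : x \in a :: l -> 0 < cross z0 x.
  rewrite inE => /orP[/eqP->|xl].
    by rewrite (_ : cross _ _ = k * cross a b) ?mulr_gt0// /cross /=; ring.
  have := Hk _ (map_f _ xl); congr (0 < _); rewrite /cross /=; ring.
(* As the base point shrinks to the origin, [orient z x y] tends to [cross x y], which is positive
   for all listed pairs. *)
have [|m m0 /(_ m m0 (lexx _)) Hm] := @small_pos [seq (cross xy.1 xy.2,
    cross z0 xy.1 - cross z0 xy.2) | xy <- es].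
  by move=> _ /mapP[xy /Hes[_ _ ?] ->].
exists (m * z0.1, m * z0.2) => -[x y] xyes; have [/= xl yl xy] := Hes _ xyes.
have E u : cross (m * z0.1, m * z0.2) u = m * cross z0 u by rewrite /cross /=; ring.
split=> //; rewrite ?orient_cross ?E; [by rewrite mulr_gt0// z0l|by rewrite mulr_gt0// z0l|].
by have := Hm _ (map_f _ xyes); rewrite /= => /ltW; congr (0 <= _); ring.
Qed.

(* The point w on the line through the origin parallel to pq with
   [cross w p = cross w q = 1]; it is the rotated dual point of the line pq. *)
Definition dual_pt p q := scaled_diff (cross p q)^-1 p q.

(** The determinant of two dual points is [orient p q r] over a product of positive determinants,
    and [orient] of the three dual points is its square over such a product. The remaining faces are
    caps because each dual point has determinant 1 with both ends of its side. *)
Lemma octahedron_caps p q r : cap_triple p q r -> 0 < orient p q r ->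
  [/\ cap_triple (dual_pt p q) (dual_pt p r) (dual_pt q r), cap_triple (dual_pt p q) p q,
      cap_triple (dual_pt q r) q r &
      [/\ cap_triple (dual_pt p r) p r, cap_triple (dual_pt p q) (dual_pt q r) q,
          cap_triple (dual_pt p q) (dual_pt p r) p &
      cap_triple (dual_pt p r) (dual_pt q r) r]].
Proof.
rewrite orient_cross => -[a0 b0 c0 _] S0.
have [a1 b1 c1] : [/\ cross p q != 0, cross q r != 0 & cross p r != 0] by rewrite !gt_eqF.
have E1 : cross (dual_pt p q) p = 1 by rewrite cross_scl crossxx (crossC p q); field.
have E2 : cross (dual_pt p q) q = 1 by rewrite cross_scl crossxx; field.
have E3 : cross (dual_pt q r) q = 1 by rewrite cross_scl crossxx (crossC q r); field.
have E4 : cross (dual_pt q r) r = 1 by rewrite cross_scl crossxx; field.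
have E5 : cross (dual_pt p r) p = 1 by rewrite cross_scl crossxx (crossC p r); field.
have E6 : cross (dual_pt p r) r = 1 by rewrite cross_scl crossxx; field.
have F1 : cross (dual_pt p q) (dual_pt p r) = (cross p q +
    cross q r - cross p r) / (cross p q * cross p r).
  by rewrite !(cross_scl, cross_scr) crossxx (crossC p q); field; rewrite ?a1 ?b1 ?c1.
have F2 : cross (dual_pt p q) (dual_pt q r) = (cross p q +
    cross q r - cross p r) / (cross p q * cross q r).
  by rewrite !(cross_scl, cross_scr) crossxx; field; rewrite ?a1 ?b1 ?c1.
have F3 : cross (dual_pt p r) (dual_pt q r) = (cross p q +
    cross q r - cross p r) / (cross p r * cross q r).
  by rewrite !(cross_scl, cross_scr) crossxx (crossC q r); field; rewrite ?a1 ?b1 ?c1.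
have G1 : 0 < cross (dual_pt p q) (dual_pt p r) by rewrite F1 divr_gt0// mulr_gt0.
have G2 : 0 < cross (dual_pt p q) (dual_pt q r) by rewrite F2 divr_gt0// mulr_gt0.
have G3 : 0 < cross (dual_pt p r) (dual_pt q r) by rewrite F3 divr_gt0// mulr_gt0.
split; last split; try by split=> //; rewrite ?orient_cross ?E1 ?E2 ?E3 ?E4 ?E5 ?E6 ?addrK ?subrr ?add0r ?ltW//; lra.
split=> //; rewrite orient_cross F1 F2 F3.
rewrite (_ : _ - _ = (cross p q + cross q r - cross p r) ^+
    2 / (cross p q * cross p r * cross q r)).
  by rewrite divr_ge0 ?sqr_ge0// ltW// !mulr_gt0.
by field; rewrite ?a1 ?b1 ?c1.
Qed.

(** A base point [z] turns every face into a signed sum of the caps spanned by [z] and its edges.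
    Each of the twelve edges borders two faces, and in the combination of the eight faces these
    terms cancel. *)
Lemma octahedron p q r : cap_triple p q r -> 0 < orient p q r -> cross q r < cross p r ->
  C p q r = - C (dual_pt p q) (dual_pt p r) (dual_pt q r).
Proof.
move=> cap S0 bc; have [K1 K2 K3 [K4 K5 K6 K7]] := octahedron_caps cap S0.
have [pq qr pr _] := cap.
set w1 := dual_pt p q in K1 K2 K5 K6 *; set w2 := dual_pt q r in K1 K3 K5 K7 *.
set w3 := dual_pt p r in K1 K4 K6 K7 *.
have [w13 w32 w12 _] := K1; have [w1p _ w1q _] := K2; have [w2q _ w2r _] := K3.
have [w3p _ w3r _] := K4.
(* The inequality between [cross q r] and [cross p r] puts [r], the vertex opposite to [w1], to the
   left of [w1]; so all six points fit in the half-plane that [base_point] needs. *)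
have w1r : 0 < cross w1 r by rewrite /w1 /dual_pt cross_scl mulr_gt0 ?invr_gt0// subr_gt0.
have [||z Hz] := @base_point w1 r [:: w3; w2; p; q; r]
  [:: (w1, w3); (w1, w2); (w3, w2); (w1, p); (w1, q); (w2, q); (w2, r); (w3, p); (w3, r); (p,
      q); (q, r); (p, r)] w1r.
- by move=> x; rewrite !inE => /or4P[/eqP->|/eqP->|/eqP->|/orP[] /eqP->].
- by move=> xy; rewrite !inE => /or4P[/eqP->|/eqP->|/eqP->|/or4P[/eqP->|/eqP->|/eqP->|/or4P[/eqP->|/eqP->|/eqP->|/or3P[] /eqP->]]] /=;
    rewrite !eqxx ?orbT.
have dF x y t : cap_triple x y t -> cap_triple z x y -> cap_triple z y t -> cap_triple z x t ->
   C z x y + C z y t = C x y t + C z x t by move=> *; exact: C_cocycle.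
have Hc x y : (x, y) \in [:: (w1, w3); (w1, w2); (w3, w2); (w1, p); (w1, q); (w2, q); (w2, r);
    (w3, p); (w3, r); (p, q); (q, r); (p, r)] -> cap_triple z x y.
  by move=> /Hz.
have {Hz} [z1 z2 z3 z4] : [/\ cap_triple z w1 w3, cap_triple z w1 w2, cap_triple z w3 w2 &
    cap_triple z w1 p].
  by split; apply: Hc; rewrite !inE eqxx ?orbT.
have [z5 z6 z7 z8] : [/\ cap_triple z w1 q, cap_triple z w2 q, cap_triple z w2 r &
    cap_triple z w3 p].
  by split; apply: Hc; rewrite !inE eqxx ?orbT.
have {Hc} [z9 z10 z11 z12] : [/\ cap_triple z w3 r, cap_triple z p q, cap_triple z q r &
    cap_triple z p r].
  by split; apply: Hc; rewrite !inE eqxx ?orbT.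
have S1 : C w1 p q = 0.
  apply: (@C_special1 _ _ _ (cross p q)) => //.
    by rewrite cross_scl crossxx (crossC p q) sub0r opprK mulVf// gt_eqF.
  by apply: pt_eq => /=; field; rewrite gt_eqF.
have S2 : C w2 q r = 0.
  apply: (@C_special1 _ _ _ (cross q r)) => //.
    by rewrite cross_scl crossxx (crossC q r) sub0r opprK mulVf// gt_eqF.
  by apply: pt_eq => /=; field; rewrite gt_eqF.
have S3 : C w3 p r = 0.
  apply: (@C_special1 _ _ _ (cross p r)) => //.
    by rewrite cross_scl crossxx (crossC p r) sub0r opprK mulVf// gt_eqF.
  by apply: pt_eq => /=; field; rewrite gt_eqF.
(* Cramer's identity for three plane vectors, with both determinants against [x] equal to 1, says
   that [u] is [v] minus [cross u v] times [x]. *)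
have aux u v x : 0 < cross u v -> cross u x = 1 -> cross v x = 1 -> C u v x = 0.
  move=> uv ux vx; apply: (@C_special2 _ _ _ (cross u v)) => //.
  suff : cross v x * u.1 = cross u x * v.1 - cross u v * x.1 /\ cross v x * u.2 =
      cross u x * v.2 - cross u v * x.2.
    by rewrite ux vx !mul1r => -[E1 E2]; apply: pt_eq.
  by split; rewrite /cross; ring.
have d1p : cross w1 p = 1 by rewrite cross_scl crossxx (crossC p q) sub0r opprK mulVf// gt_eqF.
have d1q : cross w1 q = 1 by rewrite cross_scl crossxx subr0 mulVf// gt_eqF.
have d2q : cross w2 q = 1 by rewrite cross_scl crossxx (crossC q r) sub0r opprK mulVf// gt_eqF.
have d2r : cross w2 r = 1 by rewrite cross_scl crossxx subr0 mulVf// gt_eqF.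
have d3p : cross w3 p = 1 by rewrite cross_scl crossxx (crossC p r) sub0r opprK mulVf// gt_eqF.
have d3r : cross w3 r = 1 by rewrite cross_scl crossxx subr0 mulVf// gt_eqF.
have S4 : C w1 w2 q = 0 by exact: aux.
have S5 : C w1 w3 p = 0 by exact: aux.
have S6 : C w3 w2 r = 0 by exact: aux.
move: (dF _ _ _ K2 z4 z10 z5) (dF _ _ _ K3 z6 z11 z7) (dF _ _ _ K4 z8 z12 z9).
move: (dF _ _ _ K5 z2 z6 z5) (dF _ _ _ K6 z1 z8 z4) (dF _ _ _ K7 z3 z7 z9).
move: (dF _ _ _ cap z10 z11 z12) (dF _ _ _ K1 z1 z3 z2).
rewrite S1 S2 S3 S4 S5 S6.
move: (C p q r) (C w1 w3 w2) => X Y F8 F7 F6 F5 F4 F3 F2 F1.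
have G (f : pt -> R) : (forall a b, f (a + b) = f a + f b) -> (f 0 = 0) -> f X = - f Y.
  move=> fD f0; move: (congr1 f F1) (congr1 f F2) (congr1 f F3) (congr1 f F4).
  move: (congr1 f F5) (congr1 f F6) (congr1 f F7) (congr1 f F8).
  by rewrite !fD !f0; lra.
by apply: pt_eq; [exact: (G fst)|exact: (G snd)].
Qed.

(** * Reflection and subdivision of caps *)

Local Notation mirror := (lin2 1 0 0 (-1)).

Lemma C_mirror p q r : cap_triple p q r -> C (mirror r) (mirror q) (mirror p) = mirror (C p q r).
Proof. by move=> cap; apply: C_refl => //; ring. Qed.

Lemma cross_mirror p q : cross (mirror q) (mirror p) = cross p q.
Proof. by rewrite cross_lin2 crossC; ring. Qed.

Lemma orient_mirror p q r : orient (mirror r) (mirror q) (mirror p) = orient p q r.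
Proof. by rewrite orient_lin2 /orient; ring. Qed.

Lemma cap_triple_mirror p q r : cap_triple p q r -> cap_triple (mirror r) (mirror q) (mirror p).
Proof. by move=> [a b c d]; split; rewrite ?cross_mirror ?orient_mirror. Qed.

Lemma mirror_inj x y : mirror x = mirror y -> x = y.
Proof. by case: x y => [a b] [c d] [] h1 h2; apply: pt_eq => /=; lra. Qed.

(** Dual points are taken by [mirror] to the negatives of the dual points of the mirrored sides, and
    [lin2 (-1) 0 0 1] is minus [mirror]. Covariance under it yields a second minus sign, which
    cancels that of [octahedron]. *)
Lemma octahedron_mirror p q r : cap_triple p q r -> 0 < orient p q r -> cross p q < cross p r ->
  C p q r = C (dual_pt p q) (dual_pt p r) (dual_pt q r).
Proof.
move=> cap S0 ac; have [K1 _ _ _] := octahedron_caps cap S0.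
apply: mirror_inj; rewrite -C_mirror//.
rewrite octahedron ?cross_mirror ?orient_mirror//; last exact: cap_triple_mirror.
have E x y : dual_pt (mirror x) (mirror y) = lin2 (-1) 0 0 1 (dual_pt y x).
  by rewrite /dual_pt cross_mirror; apply: pt_eq => /=; ring.
rewrite !E (C_refl mu_cov)//; last by ring.
by apply: pt_eq => /=; ring.
Qed.

Lemma C_long_base p q r : cap_triple p q r -> cross p q < cross p r -> cross q r < cross p r ->
    C p q r = 0.
Proof.
move=> cap ac bc; have [_ _ _] := cap.
rewrite le_eqVlt => /predU1P[/esym S0|S0]; first exact: C_flat.
have H1 := octahedron cap S0 bc; have := octahedron_mirror cap S0 ac.
rewrite -[RHS]opprK -H1; case: (C p q r) => x y [h1 h2].
by apply: pt_eq => /=; lra.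
Qed.

(** Cut the side [q r] at the point [y] with [cross q y = e]. The face [q y r] is flat, so the value
    splits into those of [p q y] and [p y r], and each cut lowers [cross q r] by [e]. [P] carries
    the bounds on [cross p] that all pieces inherit. *)
Lemma C_subdivide (e : R) p (P : pt -> pt -> Prop) : 0 < e ->
  (forall q r (l : R), 0 < l -> l < 1 -> P q r -> P q (mix l r q) /\ P (mix l r q) r) ->
  (forall q r, cap_triple p q r -> P q r -> cross q r <= e -> C p q r = 0) ->
  forall q r, cap_triple p q r -> P q r -> C p q r = 0.
Proof.
move=> e0 PP Psmall.
have H n : forall q r, cap_triple p q r -> P q r -> cross q r <= n%:R * e -> C p q r = 0.
  elim: n => [|n IH] q r cap Pqr bn.
    by have [_ + _ _] := cap; rewrite ltNge => /negP[]; rewrite mul0r in bn.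
  have [be|eb] := leP (cross q r) e; first exact: Psmall.
  have [pq qr pr S0] := cap.
  set l := e / cross q r; set y := mix l r q.
  have l0 : 0 < l by rewrite divr_gt0.
  have l1 : l < 1 by rewrite ltr_pdivrMr// mul1r.
  have [Pqy Pyr] := PP q r l l0 l1 Pqr; rewrite -/y in Pqy Pyr.
  have py : cross p y = l * cross p r + (1 - l) * cross p q by rewrite /cross /=; ring.
  have qy : cross q y = e.
    by transitivity (l * cross q r); [rewrite /cross /=; ring|rewrite divfK// gt_eqF].
  have yr : cross y r = cross q r - e.
    by rewrite -qy /cross /=; ring.
  have py0 : 0 < cross p y.
    have l1' : 0 < 1 - l by rewrite subr_gt0.
    by rewrite py; apply: addr_gt0; apply: mulr_gt0.
  have E1 : orient p q y = l * orient p q r by rewrite /orient /=; ring.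
  have E2 : orient p y r = (1 - l) * orient p q r by rewrite /orient /=; ring.
  have E3 : orient q y r = 0 by rewrite /orient /=; ring.
  have c1 : cap_triple p q y by split=> //; rewrite ?qy// E1 mulr_ge0// ltW.
  have c2 : cap_triple p y r.
    by split=> //; rewrite ?yr ?subr_gt0// E2 mulr_ge0// subr_ge0 ltW.
  have c3 : cap_triple q y r by split=> //; [rewrite qy|rewrite yr subr_gt0|rewrite E3].
  have := C_cocycle mu_val c1 c2 c3 cap.
  rewrite (C_flat _ c3)// add0r => <-.
  rewrite (Psmall _ _ c1)// ?qy// add0r IH// yr.
  by move: bn; rewrite -natr1 mulrDl mul1r; lra.
move=> q r cap Pqr; have [_ qr _ _] := cap.
apply: (H (Num.bound (cross q r / e))) => //.
by rewrite -ler_pdivrMr// ltW// archi_boundP// divr_ge0// ltW.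
Qed.

Lemma cross_mixr p l q r : cross p (mix l r q) = l * cross p r + (1 - l) * cross p q.
Proof. by rewrite /cross /=; ring. Qed.

(** [cross p] increases along the side from [q] to [r], so every piece has its base longer than its
    first side; a piece [y z] with [cross y z] at most half of [cross p q] also has it longer than
    its second side. *)
Lemma C_second_longer p q r : cap_triple p q r -> cross p q < cross p r -> C p q r = 0.
Proof.
move=> cap ac; have [pq _ _ _] := cap.
apply: (@C_subdivide (cross p q / 2) p (fun y z =>
    cross p q / 2 < cross p y /\ cross p y < cross p z)) => //.
- by rewrite divr_gt0.
- move=> y z l l0 l1 [h1 h2]; rewrite !cross_mixr; have :=
    mulr_gt0 l0 (_ : 0 < cross p z - cross p y).
  have := mulr_gt0 (_ : 0 < 1 - l) (_ : 0 < cross p z - cross p y).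
  by rewrite !subr_gt0 => /(_ l1 h2) g1 /(_ h2) g2; split; split; lra.
- by move=> y z cyz [h1 h2] h3; apply: C_long_base => //; lra.
- by split=> //; lra.
Qed.

(** By reflecting [C_second_longer] it is enough that the base exceeds the second side. On the whole
    side [q r] the value of [cross p] stays above half the minimum of its end values, so pieces no
    longer than that qualify. *)
Lemma C_eq0 p q r : cap_triple p q r -> C p q r = 0.
Proof.
move=> cap; have [pq qr pr _] := cap.
have first_longer x y z : cap_triple x y z -> cross y z < cross x z -> C x y z = 0.
  move=> cxyz h; apply: mirror_inj; rewrite -C_mirror// lin20.
  by apply: C_second_longer; rewrite ?cross_mirror//; exact: cap_triple_mirror.
have m0 : 0 < Num.min (cross p q) (cross p r) by rewrite lt_min pq.
apply: (@C_subdivide (Num.min (cross p q) (cross p r) / 2) p (fun y z =>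
  Num.min (cross p q) (cross p r) / 2 < cross p y /\ Num.min (cross p q) (cross p r) / 2 < cross p z)) => //.
- by rewrite divr_gt0.
- move=> y z l l0 l1 [h1 h2]; rewrite !cross_mixr.
  have g1 : 0 < l * (cross p z - Num.min (cross p q) (cross p r) / 2) by rewrite mulr_gt0// subr_gt0.
  have g2 : 0 < (1 - l) * (cross p y - Num.min (cross p q) (cross p r) / 2) by rewrite mulr_gt0// subr_gt0.
  by split; split=> //; lra.
- by move=> y z cyz [h1 h2] h3; apply: first_longer => //; exact: le_lt_trans h2.
- have : Num.min (cross p q) (cross p r) <= cross p q by rewrite ge_min lexx.
  have : Num.min (cross p q) (cross p r) <= cross p r by rewrite ge_min lexx orbT.
  by move=> h1 h2; split; lra.
Qed.

End Octahedron.

(** * Removing caps *)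

Section Sweep.
Variable R : realType.
Local Notation pt := (R * R)%type.
Implicit Types (p q r x y z w v : pt) (s t : seq pt) (P X : set pt).

Lemma hull_compact t : compact (conv_hull t).
Proof.
elim: t => [|x [|y t] IH].
- rewrite (_ : conv_hull [::] = set0); first exact: compact0.
  by apply/seteqP; split=> // z /hull_inhab[].
- by rewrite hull1; exact: compact_set1.
rewrite (hull_cons x (mem_head y t)); set Y := conv_hull (y :: t) in IH *.
have -> : join [set x] Y = (fun u : R * pt => mix u.1 x u.2) @` (`[0, 1]%classic `*` Y).
  apply/seteqP; split => [z [l [_ [b [l0 l1 -> Yb ->]]]]|_ [[l b] [/= + Yb] <-]].
    by exists (l, b) => //; split => //=; rewrite in_itv /= l0.
  by rewrite in_itv /= => /andP[l0 l1]; exists l, x, b.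
apply: continuous_compact; last by apply: compact_setX IH; exact: segment_compact.
apply: continuous_subspaceT => u.
have c1 : fst u0 @[u0 --> u] --> u.1 by exact: cvg_fst.
have c2 : (snd u0).1 @[u0 --> u] --> u.2.1.
  by apply: (@cvg_comp _ _ _ snd fst _ (nbhs u.2)); [exact: cvg_snd|exact: cvg_fst].
have c3 : (snd u0).2 @[u0 --> u] --> u.2.2.
  by apply: (@cvg_comp _ _ _ snd snd _ (nbhs u.2)); [exact: cvg_snd|exact: cvg_snd].
rewrite /mix; apply: (@cvg_pair _ _ _ _ (nbhs _) (nbhs _)) => /=; apply: cvgD; apply: cvgM =>
    //; try exact: cvg_cst.
  by apply: cvgB => //; exact: cvg_cst.
by apply: cvgB => //; exact: cvg_cst.
Qed.

Lemma hull_closed t : closed (conv_hull t).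
Proof. by apply: compact_closed; [exact: norm_hausdorff|exact: hull_compact]. Qed.

Definition cut P (h : R) := P `&` [set z | z.2 <= h].

(** By compactness the section has extreme points. [w] is the right end and [y] the left one, so
    [w], [x], [y] is counterclockwise for [x] above the level. *)
Lemma section_ends t (h : R) : (exists2 z, conv_hull t z & z.2 = h) ->
  exists w y, [/\ conv_hull t w, conv_hull t y, w.2 = h, y.2 = h &
    forall z, conv_hull t z -> z.2 = h -> y.1 <= z.1 <= w.1].
Proof.
move=> [z0 tz0 z0h]; set A := conv_hull t `&` [set z | z.2 = h].
have A0 : A !=set0 by exists z0.
have cA : compact A.
  apply: (subclosed_compact _ (@hull_compact t)); last by move=> z [].
  apply: closedI; first exact: hull_closed.
  have /continuous_closedP : continuous (@snd R R) by move=> z; exact: cvg_snd.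
  by move=> /(_ [set x | x = h] (@closed_eq _ h)).
have cf : {within A, continuous (@fst R R)}.
  by apply: continuous_subspaceT => z; exact: cvg_fst.
have [w + Hw] := compact_EVT_max A0 cA cf; have [y + Hy] := compact_EVT_min A0 cA cf.
rewrite !inE => -[ty yh] [tw wh].
by exists w, y; split=> // z tz zh; rewrite Hw ?Hy// inE.
Qed.

Lemma segment_level X w y z : cvx_set X -> X w -> X y -> w.2 = z.2 -> y.2 = z.2 ->
  y.1 <= z.1 <= w.1 -> X z.
Proof.
move=> cX Xw Xy wz yz /andP[h1 h2]; have [e|e] := eqVneq w.1 y.1.
  suff -> : z = w by []. by apply: pt_eq => //; lra.
have d0 : 0 < w.1 - y.1 by rewrite subr_gt0 lt_neqAle eq_sym e (le_trans h1).
suff -> : z = mix ((z.1 - y.1) / (w.1 - y.1)) w y.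
  by apply: cX => //; rewrite ?divr_ge0 ?ler_pdivrMr ?mul1r ?subr_ge0 ?lerB// (le_trans h1).
by case: z wz yz h1 h2 => z1 z2 /= wz yz _ _; apply: pt_eq => /=;
  rewrite ?wz ?yz; field; rewrite subr_eq0.
Qed.

Lemma cvx_below h : cvx_set [set z : pt | z.2 <= h].
Proof. by move=> l p q l0 l1 /= ph qh; have := ler_wpM2l l0 ph; have := ler_wpM2l (_ : 0 <=
    1 - l) qh; rewrite subr_ge0 => /(_ l1); lra. Qed.

Lemma cvx_above h : cvx_set [set z : pt | h <= z.2].
Proof. by move=> l p q l0 l1 /= ph qh; have := ler_wpM2l l0 ph; have := ler_wpM2l (_ : 0 <=
    1 - l) qh; rewrite subr_ge0 => /(_ l1); lra. Qed.

Lemma cvxI X Y : cvx_set X -> cvx_set Y -> cvx_set (X `&` Y).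
Proof. by move=> cX cY l p q l0 l1 [Xp Yp] [Xq Yq]; split; [exact: cX|exact: cY]. Qed.

(** The predicate [f], and not the level, decides which listed points count as lower. In [cut_slab]
    this describes the cuts at two levels by one and the same list of lower points. *)
Lemma cut_hull s (f : pred pt) h w y a0 b0 : a0 \in s -> f a0 -> b0 \in s -> ~~ f b0 ->
  (forall p, p \in s -> f p -> p.2 <= h) -> (forall p, p \in s -> ~~ f p -> h <= p.2) ->
  conv_hull s w -> conv_hull s y -> w.2 = h -> y.2 = h ->
  (forall z, conv_hull s z -> z.2 = h -> y.1 <= z.1 <= w.1) ->
  cut (conv_hull s) h = conv_hull (w :: y :: [seq p <- s | f p]).
Proof.
move=> a0s fa0 b0s fb0 Hlo Hhi sw sy wh yh Hwy; set u := [seq p <- s | f p].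
have us : conv_hull u `<=` conv_hull s by apply: hull_sub => p; rewrite mem_filter => /andP[].
apply/seteqP; split; last first.
  apply: hull_min; first by apply: cvxI; [exact: hull_convex|exact: cvx_below].
  move=> p; rewrite !inE => /or3P[/eqP->|/eqP->|]; try by split=> //=; rewrite ?wh ?yh.
  by rewrite mem_filter => /andP[fp ps]; split; [exact: hull_mem|exact: Hlo].
set K := conv_hull (w :: y :: u).
have uK : conv_hull u `<=` K by apply: hull_sub => p pu; rewrite !inE pu !orbT.
have Kh z : conv_hull s z -> z.2 = h -> K z.
  move=> sz zh; apply: (@segment_level _ w y); rewrite ?zh//; try exact: Hwy.
  - exact: hull_convex.
  - by apply: hull_mem; rewrite !inE eqxx.
  - by apply: hull_mem; rewrite !inE eqxx orbT.
move=> z [sz /= zh].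
have E : conv_hull s = conv_hull (u ++ [seq p <- s | ~~ f p]).
  by apply: hull_eq => p; rewrite mem_cat !mem_filter -andb_orl orbN.
have a0u : a0 \in u by rewrite mem_filter fa0.
have b0u : b0 \in [seq p <- s | ~~ f p] by rewrite mem_filter fb0.
move: (sz); rewrite E (hull_cat a0u b0u) => -[l [a [b [l0 l1 ua ub zE]]]].
have ah : a.2 <= h.
  by apply: (hull_min (@cvx_below h)) ua => p; rewrite mem_filter => /andP[fp /Hlo]; exact.
have bh : h <= b.2.
  by apply: (hull_min (@cvx_above h)) ub => p; rewrite mem_filter => /andP[fp /Hhi]; exact.
have sb : conv_hull s b by apply: hull_sub ub => p; rewrite mem_filter => /andP[].
have [zh'|zh'] := eqVneq z.2 h; first exact: Kh.
have zlt : z.2 < h by rewrite lt_neqAle zh'.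
have alt : a.2 < h.
  rewrite lt_neqAle ah andbT; apply/eqP => aE; move: zlt; rewrite zE /= aE.
  by have := ler_wpM2l (_ : 0 <= 1 - l) bh; rewrite subr_ge0 => /(_ l1); lra.
(* [mix m a b] is where the segment from the lower part to the upper part crosses level [h]; [z]
   lies between it and [a]. *)
set m := (b.2 - h) / (b.2 - a.2).
have ba : 0 < b.2 - a.2 by rewrite subr_gt0 (lt_le_trans alt).
have m0 : 0 <= m by rewrite divr_ge0 ?subr_ge0// ltW// -subr_gt0.
have m1 : m < 1 by rewrite ltr_pdivrMr// mul1r; lra.
have ml : m <= l by rewrite ler_pdivrMr//; move: zlt; rewrite zE /=; lra.
have m1' : 0 < 1 - m by rewrite subr_gt0.
have Kc : K (mix m a b).
  apply: Kh; first by apply: hull_convex => //; [exact: ltW|exact: us].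
  by rewrite /= /m; field; rewrite gt_eqF.
have -> : z = mix ((l - m) / (1 - m)) a (mix m a b).
  by rewrite zE; apply: pt_eq => /=; field; rewrite gt_eqF.
apply: hull_convex => //; [by rewrite divr_ge0 ?subr_ge0// ltW|by rewrite ler_pdivrMr// mul1r lerB|exact: uK].
Qed.

Lemma cut_all s h : (forall p, p \in s -> p.2 <= h) -> cut (conv_hull s) h = conv_hull s.
Proof. by move=> H; apply/setIidPl; apply: hull_min => //; exact: cvx_below. Qed.

Lemma Po0 P : Po P -> P 0.
Proof. by move=> /PoP[_ [r r0 rP]]; apply: rP; rewrite normr0. Qed.

Lemma min_level s (h : R) : (exists2 p, p \in s & h < p.2) ->
  exists p, [/\ p \in s, h < p.2 & forall q, q \in s -> h < q.2 -> p.2 <= q.2].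
Proof.
elim: s => [[]//|a s IH] [p]; rewrite inE.
have [/hasP[q qs hq] _|/hasPn noq] := boolP (has (fun q => h < q.2) s).
  have [|b [bs hb bmin]] := IH; first by exists q.
  have [ha|ha] := ltP h a.2; last first.
    exists b; split; rewrite ?inE ?bs ?orbT// => c; rewrite inE => /orP[/eqP->|]; last exact: bmin.
    by rewrite ltNge ha.
  have [ab|ba] := leP a.2 b.2.
    exists a; split; rewrite ?mem_head// => c; rewrite inE => /orP[/eqP->//|cs hc].
    exact: le_trans ab (bmin _ cs hc).
  exists b; split; rewrite ?inE ?bs ?orbT// => c; rewrite inE => /orP[/eqP->|]; last exact: bmin.
  by move=> _; exact: ltW.
move=> /orP[/eqP-> ha|ps hp]; last by have := noq _ ps; rewrite hp.
exists a; split; rewrite ?mem_head// => c; rewrite inE => /orP[/eqP->//|cs hc].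
by have := noq _ cs; rewrite hc.
Qed.

Lemma Po_low s (h : R) : Po (conv_hull s) -> 0 < h -> exists2 p, p \in s & p.2 <= h.
Proof.
move=> /Po0 s0 h0; apply: contrapT => H; suff : (0 : pt).2 >= h by rewrite leNgt h0.
apply: (hull_min (@cvx_above h)) s0 => p ps /=; rewrite leNgt; apply/negP => /ltW ph.
by apply: H; exists p.
Qed.

Lemma cut_ball P h : Po P -> 0 < h -> exists2 r : R, 0 < r &
  forall x, `|x.1| < r -> `|x.2| < r -> cut P h x.
Proof.
move=> /PoP[_ [r r0 rP]] h0; exists (Num.min r h); first by rewrite lt_min r0.
move=> x; rewrite !lt_min => /andP[x1 _] /andP[x2 /ltW xh]; split; first exact: rP.
exact: le_trans (ler_norm _) xh.
Qed.

Lemma level_meet s h : Po (conv_hull s) -> 0 < h -> (exists2 p, p \in s & h < p.2) ->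
  exists2 z, conv_hull s z & z.2 = h.
Proof.
move=> Ps h0 [p ps hp]; have p0 := lt_trans h0 hp.
exists (mix (h / p.2) p 0); last by rewrite /= mulr0 addr0 divfK// gt_eqF.
apply: hull_convex; rewrite ?divr_ge0 ?ler_pdivrMr ?mul1r ?ltW//; first exact: hull_mem.
exact: Po0.
Qed.

Lemma cut_Po P h : Po P -> 0 < h -> Po (cut P h).
Proof.
move=> PP h0; apply/PoP; split; last exact: cut_ball.
have [[s Ps] _] := PP; rewrite {P}Ps in PP *.
have [hi|lo] := pselect (exists2 p, p \in s & h < p.2).
  have [w [y [sw sy wh yh Hwy]]] := section_ends (level_meet PP h0 hi).
  have [b bs hb] := hi; have [a as_ ha] := Po_low PP h0.
  exists (w :: y :: [seq p <- s | p.2 <= h]).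
  apply: (@cut_hull s (fun p => p.2 <= h) h w y a b) => //; first by rewrite -ltNge.
  by move=> p _; rewrite -ltNge => /ltW.
exists s; apply: cut_all => p ps; rewrite leNgt; apply/negP => hp; apply: lo; by exists p.
Qed.

Variable mu : set pt -> pt.
Hypotheses (mu_val : is_valuation mu) (mu_cov : covariant mu).
Local Notation C := (cap_val mu).
Hypothesis C0 : forall p q r, cap_triple p q r -> C p q r = 0.

Lemma cap_remove w x y t : Po (conv_hull t) -> cap_triple w x y ->
  conv_hull t w -> conv_hull t y ->
  (forall z, z \in t -> [/\ 0 <= orient w x z, 0 <= orient x y z & 0 <= orient w y z]) ->
  mu (conv_hull (x :: t)) = mu (conv_hull t).
Proof. by move=> Pt cap tw ty H; rewrite (cap_add mu_val Pt cap tw ty H) C0// addr0. Qed.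

(* Between two consecutive vertex levels the polygon is a trapezoid
   [w1 w2 y2 y1], which is removed as two triangular caps. *)
Lemma cut_slab s h h' b : Po (conv_hull s) -> 0 < h -> h < h' -> b \in s -> b.2 = h' ->
  (forall p, p \in s -> h < p.2 -> h' <= p.2) ->
  mu (cut (conv_hull s) h') = mu (cut (conv_hull s) h).
Proof.
move=> Ps h0 hh bs bh Hs; set P := conv_hull s in Ps *.
have h'0 := lt_trans h0 hh.
have hb : h < b.2 by rewrite bh.
have [a as_ ah] := Po_low Ps h0.
have [w1 [y1 [Pw1 Py1 w1h y1h H1]]] := section_ends (level_meet Ps h0 (ex_intro2 _ _ b bs hb)).
have [|w2 [y2 [Pw2 Py2 w2h y2h H2]]] := @section_ends s h'.
  by exists b => //; exact: hull_mem.
pose f := fun p : pt => p.2 <= h; pose u := [seq p <- s | f p].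
have E1 : cut P h = conv_hull (w1 :: y1 :: u).
  apply: (@cut_hull s f h w1 y1 a b) => //; first by rewrite /f -ltNge.
  by move=> p _; rewrite /f -ltNge => /ltW.
have E2 : cut P h' = conv_hull (w2 :: y2 :: u).
  apply: (@cut_hull s f h' w2 y2 a b) => //; first by rewrite /f -ltNge.
    by move=> p _ /le_trans; apply; exact: ltW.
  by move=> p ps; rewrite /f -ltNge; exact: Hs.
set u1 := w1 :: y1 :: u in E1 *.
have E3 : cut P h' = conv_hull (w2 :: y2 :: u1).
  apply/seteqP; split.
    by rewrite E2; apply: hull_sub => p; rewrite !inE => /or3P[]->; rewrite ?orbT.
  apply: hull_min; first by rewrite E2; exact: hull_convex.
  move=> p; rewrite !inE => /or4P[/eqP->|/eqP->|/eqP->|/orP[/eqP->|pu]].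
  - by split; rewrite //= w2h.
  - by split; rewrite //= y2h.
  - by split; rewrite //= w1h ltW.
  - by split; rewrite //= y1h ltW.
  - by rewrite E2; apply: hull_mem; rewrite !inE pu !orbT.
have [r r0 rP] := cut_ball Ps h0.
have Pr (e : R) : `|e| < r -> P (e, 0) by move=> er; have [] := rP (e, 0) er; rewrite ?normr0.
have r20 : 0 < r / 2 by rewrite divr_gt0.
have rr : `|r / 2| < r by rewrite gtr0_norm//; lra.
have rr' : `|- (r / 2)| < r by rewrite normrN.
have m0 : 0 < h / h' by rewrite divr_gt0.
have m1 : h / h' < 1 by rewrite ltr_pdivrMr// mul1r.
(* The segment from [x] to [(e, 0)] meets level [h] inside the section. Taking e = r / 2 and e = - r
   / 2 makes the bounds on [x] strict, which gives the positive determinants below. *)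
have lvl (x : pt) (e : R) : P x -> x.2 = h' -> `|e| < r ->
    y1.1 <= h / h' * x.1 + (1 - h / h') * e <= w1.1.
  move=> Px xh er; apply: (H1 (mix (h / h') x (e, 0))).
    by apply: hull_convex => //; [exact: ltW|exact: ltW|exact: Pr].
  by rewrite /= xh mulr0 addr0 divfK// gt_eqF.
have mr : 0 < (1 - h / h') * (r / 2) by rewrite mulr_gt0// subr_gt0.
have dtw x : P x -> x.2 = h' -> 0 < cross w1 x.
  move=> Px xh; have /andP[_ K] := lvl _ _ Px xh rr.
  rewrite (_ : cross w1 x = h' * (w1.1 - h / h' * x.1)); first by apply: mulr_gt0 => //; lra.
  by rewrite /cross w1h xh; field; rewrite gt_eqF.
have dty x : P x -> x.2 = h' -> 0 < cross x y1.
  move=> Px xh; have /andP[K _] := lvl _ _ Px xh rr'.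
  rewrite (_ : cross x y1 = h' * (h / h' * x.1 - y1.1)); first by apply: mulr_gt0 => //; lra.
  by rewrite /cross y1h xh; field; rewrite gt_eqF.
have wy1 : y1.1 < w1.1.
  have := dtw _ Py2 y2h; have := dty _ Py2 y2h; rewrite /cross y1h w1h y2h => K1 K2.
  by rewrite -(ltr_pM2r h'0); lra.
have wy2 : y2.1 <= w2.1 by have /andP[] := H2 _ Pw2 w2h.
(* The segment from [x] down to [z] meets level [h] between [y1] and [w1], so [z] lies inside the
   lines [w1 x] and [x y1]. *)
have supp x z : P x -> x.2 = h' -> P z -> z.2 <= h -> 0 <= orient w1 x z /\ 0 <= orient x y1 z.
  move=> Px xh Pz zh; have zh' : 0 < h' - z.2 by rewrite subr_gt0 (le_lt_trans zh).
  set m := (h - z.2) / (h' - z.2).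
  have /andP[K1 K2] : y1.1 <= m * x.1 + (1 - m) * z.1 <= w1.1.
    apply: (H1 (mix m x z)); last by rewrite /= xh /m; field; rewrite gt_eqF.
    apply: hull_convex => //; first by rewrite divr_ge0 ?(ltW zh')// subr_ge0.
    by rewrite ler_pdivrMr// mul1r; lra.
  split.
    rewrite (_ : orient _ _ _ = (h' - z.2) * (w1.1 - (m * x.1 + (1 - m) * z.1))).
      by rewrite mulr_ge0 ?(ltW zh')// subr_ge0.
    by rewrite /orient /m xh w1h; field; rewrite gt_eqF.
  rewrite (_ : orient _ _ _ = (h' - z.2) * ((m * x.1 + (1 - m) * z.1) - y1.1)).
    by rewrite mulr_ge0 ?(ltW zh')// subr_ge0.
  by rewrite /orient /m xh y1h; field; rewrite gt_eqF.
have u1P z : z \in u1 -> P z /\ z.2 <= h.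
  rewrite !inE => /or3P[/eqP->|/eqP->|]; rewrite ?w1h ?y1h//.
  by rewrite mem_filter => /andP[? ?]; split=> //; exact: hull_mem.
have P1 : Po (conv_hull u1) by rewrite -E1; exact: cut_Po.
have cap1 : cap_triple w1 y2 y1.
  split; [exact: dtw|exact: dty| |].
    by rewrite /cross w1h y1h; have := mulr_gt0 h0 (_ : 0 < w1.1 - y1.1); rewrite subr_gt0 =>
        /(_ wy1); lra.
  rewrite /orient w1h y1h y2h subrr mulr0 sub0r -mulrN; apply: mulr_ge0; lra.
have M1 : mu (conv_hull (y2 :: u1)) = mu (conv_hull u1).
  apply: cap_remove cap1 _ _ _ => //; try by apply: hull_mem; rewrite !inE eqxx ?orbT.
  move=> z /u1P[Pz zh]; have [K1 K2] := supp _ _ Py2 y2h Pz zh; split=> //.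
  rewrite (_ : orient _ _ _ = (w1.1 - y1.1) * (h - z.2)); first by apply: mulr_ge0; lra.
  by rewrite /orient w1h y1h; ring.
rewrite E3 E1 -M1.
have PM : Po (conv_hull (y2 :: u1)) by apply: Po_sup P1 _; exact: hull_subcons.
(* When the upper section is a single point, the trapezoid is a triangle and one cap suffices. *)
have [e|e] := eqVneq w2 y2.
  by rewrite hull_absorb// e; apply: hull_mem; rewrite mem_head.
have wy2' : y2.1 < w2.1.
  rewrite lt_neqAle wy2 andbT; apply: contra e => /eqP e.
  by apply/eqP/pt_eq => //; rewrite w2h.
apply: (@cap_remove w1 w2 y2) => //; try by apply: hull_mem; rewrite !inE eqxx ?orbT.
  split; [exact: dtw| |exact: dtw|].
    by rewrite /cross w2h y2h; have := mulr_gt0 h'0 (_ : 0 < w2.1 - y2.1); rewrite subr_gt0 =>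
        /(_ wy2'); lra.
  rewrite (_ : orient _ _ _ = (h' - h) * (w2.1 - y2.1)); first by apply: mulr_ge0; lra.
  by rewrite /orient w1h w2h y2h; ring.
move=> z; rewrite inE => /orP[/eqP->|/u1P[Pz zh]].
  rewrite !orient_rr; split=> //.
  rewrite (_ : orient _ _ _ = (h' - h) * (w2.1 - y2.1)); first by apply: mulr_ge0; lra.
  by rewrite /orient w1h w2h y2h; ring.
have [K1 _] := supp _ _ Pw2 w2h Pz zh; have [K2 _] := supp _ _ Py2 y2h Pz zh; split=> //.
rewrite (_ : orient _ _ _ = (w2.1 - y2.1) * (h' - z.2)); first by apply: mulr_ge0; lra.
by rewrite /orient w2h y2h; ring.
Qed.

(** Induction on the number of listed points above [h]: up to the lowest of their levels [cut_slab]
    applies, and at that level at least one point is no longer counted. *)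
Lemma mu_cut P h : Po P -> 0 < h -> mu (cut P h) = mu P.
Proof.
move=> PP; have [[s Ps] _] := PP; rewrite {P}Ps in PP *.
move=> h0; have [n cn] := ubnP (count (fun p : pt => h < p.2) s).
elim: n => [//|n IH] in s h h0 PP cn *; rewrite ltnS in cn.
have [hi|lo] := pselect (exists2 p, p \in s & h < p.2); last first.
  by rewrite cut_all// => p ps; rewrite leNgt; apply/negP => hp; apply: lo; exists p.
have [b [bs hb bmin]] := min_level hi.
rewrite -(@cut_slab s h b.2 b)//.
apply: IH => //; first exact: lt_trans hb.
apply: leq_trans cn.
have -> : count (fun p => h < p.2) s = (count (fun p : pt => b.2 < p.2)%R s +
    count (fun p : pt => (h < p.2) && (p.2 <= b.2))%R s)%N.
  rewrite -count_predUI (@eq_count _ (predI _ _) pred0) ?count_pred0 ?addn0.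
    by apply: eq_count => p /=; have [bp|pb] := ltP b.2 p.2;
        rewrite ?andbT ?andbF ?orbF// (lt_trans hb).
  by move=> p /=; have [bp|pb] := ltP b.2 p.2; rewrite ?andbF.
rewrite -addn1 leq_add2l -has_count; apply/hasP; exists b => //; by rewrite hb lexx.
Qed.

(** * Truncation to a centred square *)

Local Notation rot := (lin2 0 (-1) 1 0).

Lemma rot_image P z : (rot @` P) z <-> P (z.2, - z.1).
Proof.
split=> [[x Px <-]|Pz]; last by exists (z.2, - z.1) => //; apply: pt_eq => /=; ring.
suff -> : ((rot x).2, - (rot x).1) = x by [].
by apply: pt_eq => /=; ring.
Qed.

Lemma rot_Po P : Po P -> Po (rot @` P).
Proof.
move=> /PoP[[s ->] [r r0 rP]]; apply/PoP; split; first by rewrite lin2_hull; exists (map rot s).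
by exists r => // x x1 x2; apply/rot_image; apply: rP; rewrite //= normrN.
Qed.

(** Cutting from above and turning by a right angle, four times in a row, trims all four sides and
    restores the position. *)
Let step (e : R) P := rot @` (cut P e).

Let step_Po e P : 0 < e -> Po P -> Po (step e P).
Proof. by move=> e0 PP; apply: rot_Po; apply: cut_Po. Qed.

Let mu_step e P : 0 < e -> Po P -> mu (step e P) = rot (mu P).
Proof.
move=> e0 PP; rewrite /step mu_cov ?mu_cut//; last exact: cut_Po.
by left; ring.
Qed.

(** The fourth power of [rot] is the identity, so the square [Q] left after four steps has the value
    of [P]. Covariance under minus the identity gives [mu Q = - mu Q]. *)
Lemma mu_eq0 P : Po P -> mu P = 0.
Proof.
move=> PP; have [_ [r r0 rP]] := (PoP P).1 PP.
set e := r / 2; have e0 : 0 < e by rewrite divr_gt0.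
pose Q : set pt := [set z | `|z.1| <= e /\ `|z.2| <= e].
have QE : step e (step e (step e (step e P))) = Q.
  apply/seteqP; split=> z.
    move=> /rot_image[/rot_image[/rot_image[/rot_image[_ /= h1] /= h2] /= h3] /= h4].
    by rewrite /Q /= !ler_norml; split; apply/andP; split; lra.
  move=> [z1 z2]; have Pz : P z.
    by apply: rP; [apply: le_lt_trans z1 _|apply: le_lt_trans z2 _]; rewrite /e; lra.
  move: z1 z2; rewrite !ler_norml => /andP[h1 h2] /andP[h3 h4].
  apply/rot_image; split; rewrite /=; last by lra.
  apply/rot_image; split; rewrite /=; last by lra.
  apply/rot_image; split; rewrite /=; last by lra.
  apply/rot_image; split; rewrite /= !opprK; last by lra.
  by case: z Pz {h1 h2 h3 h4}.
have PQ : Po Q by rewrite -QE; do !apply: step_Po.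
have muQ : mu Q = mu P.
  rewrite -QE !mu_step//; try by do ?apply: step_Po.
  by apply: pt_eq => /=; ring.
have NQ : lin2 (-1) 0 0 (-1) @` Q = Q.
  apply/seteqP; split=> [_ [z [z1 z2] <-]|z [z1 z2]].
    by split=> /=; rewrite ?mul0r ?addr0 ?add0r mulN1r normrN.
  exists (- z.1, - z.2); first by split=> /=; rewrite normrN.
  by apply: pt_eq => /=; ring.
have := mu_cov (a := -1) (b := 0) (c := 0) (d := -1) (P := Q) _ PQ.
rewrite NQ muQ => K.
have {K} : mu P = lin2 (-1) 0 0 (-1) (mu P) by apply: K; left; ring.
by case: (mu P) => x y [K1 K2]; apply: pt_eq => /=; lra.
Qed.

End Sweep.

(** * Linear maps and planar Lebesgue measure *)

Section LebesguePlane.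
Variable R : realType.
Local Notation pt := (R * R)%type.
Local Notation RR := (measurableTypeR R).
Local Notation leb := (@lebesgue_measure R).
Local Notation leb2 := (@leb2 R).

Lemma leb_shift (c : R) (A : set RR) : measurable A -> leb ((fun x : RR => (x +
    c : RR)) @^-1` A) = leb A.
Proof.
move=> mA; have mf : measurable_fun setT (fun x : RR => x + c : RR).
  by apply: measurable_realfun.measurable_funD => //; exact: measurable_cst.
apply/esym.
apply: (@lebesgue_measure_unique R (measure_function_pushforward__canonical__measure_function_Measure leb mf)) => // X.
move=> [[a b] _ <-].
rewrite /= /pushforward (_ : _ @^-1` _ = `]a - c, b - c]%classic).
  rewrite !lebesgue_measure_itv/= !lte_fin ltrD2r.
  by case: ifPn => // _; rewrite -!EFinB; congr EFin; ring.
by apply/seteqP; split=> x; rewrite /= !in_itv /= ltrBlDr lerBrDr.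
Qed.

Lemma leb_scale_pos (k : R) (A : set RR) : 0 < k -> measurable A ->
  leb A = (k%:E * leb ((fun x : RR => (k * x)%R : RR) @^-1` A))%E.
Proof.
move=> k0 mA; have mf : measurable_fun setT (fun x : RR => k * x : RR).
  by apply: measurable_realfun.measurable_funM => //; exact: measurable_cst.
apply: (@lebesgue_measure_unique R (mscale (NngNum (ltW k0)) (measure_function_pushforward__canonical__measure_function_Measure leb mf))) => // X.
move=> [[a b] _ <-].
transitivity (k%:E * leb ((fun x : RR => (k * x)%R : RR) @^-1` `]a, b]%classic))%E; last by [].
rewrite (_ : _ @^-1` _ = `]a / k, b / k]%classic).
  rewrite !lebesgue_measure_itv/= !lte_fin ltr_pM2r ?invr_gt0//.
  case: ifPn => _; last by rewrite mule0.
  by rewrite -!EFinD -EFinM -mulrBl mulrCA divff ?mulr1 ?gt_eqF.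
by apply/seteqP; split=> x; rewrite /= !in_itv /= ltr_pdivrMr// ler_pdivlMr// ![x * k]mulrC.
Qed.

Lemma leb_scale (k : R) (A : set RR) : k != 0 -> measurable A ->
  leb A = (`|k|%:E * leb ((fun x : RR => (k * x)%R : RR) @^-1` A))%E.
Proof.
move=> k0 mA; have [kp|kn] := ltP 0 k; first by rewrite gtr0_norm//; exact: leb_scale_pos.
have kn' : 0 < - k by rewrite oppr_gt0 lt_neqAle k0.
have mf : measurable_fun setT (fun x : RR => (- k) * x : RR).
  by apply: measurable_realfun.measurable_funM => //; exact: measurable_cst.
rewrite (leb_scale_pos kn' mA) ltr0_norm -?oppr_gt0//; congr (_ * _)%E.
rewrite -[LHS]lebesgue_measureN /pushforward.
  by congr (leb _); apply/seteqP; split=> x /=; rewrite mulrNN.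
by rewrite -[X in measurable X]setTI; exact: mf.
Qed.

Definition preserving (f : RR * RR -> RR * RR) := measurable_fun setT f /\
  forall A, measurable A -> leb2 (f @^-1` A) = leb2 A.

Lemma preserving_comp f g : preserving f -> preserving g -> preserving (f \o g).
Proof.
move=> [mf pf] [mg pg]; split; first exact: measurableT_comp.
move=> A mA; rewrite comp_preimage pg ?pf//.
by rewrite -[X in measurable X]setTI; exact: mf.
Qed.

(** The product measure is determined by its values on rectangles. *)
Lemma preserving_rect f : measurable_fun setT f ->
  (forall A B, measurable A -> measurable B -> leb2 (f @^-1` (A `*` B)) = (leb A * leb B)%E) ->
  preserving f.
Proof.
move=> mf H; split=> // A mA; apply/esym.
exact: (@product_measure_unique _ _ _ _ _ leb leb (measure_function_pushforward__canonical__measure_function_Measure leb2 mf)).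
Qed.

Lemma preserving_swap : preserving (fun x => (x.2, x.1)).
Proof.
apply: preserving_rect.
  by apply: measurable_fun_pair; [exact: measurable_snd|exact: measurable_fst].
move=> A B mA mB; rewrite (_ : _ @^-1` _ = B `*` A).
  by rewrite /leb2 product_measure1E// muleC.
by apply/seteqP; split => x [].
Qed.

Lemma preserving_diag (a d : R) : `|a * d| = 1 -> preserving (fun x => (a * x.1, d * x.2)).
Proof.
move=> ad; have [a0 d0] : a != 0 /\ d != 0.
  by split; apply: contraTneq (ltr01 : 0 < 1 :> R) => e; rewrite -ad e ?mul0r ?mulr0 normr0 ltxx.
have mf (k : R) : measurable_fun setT (fun x : RR => k * x : RR).
  by apply: measurable_realfun.measurable_funM => //; exact: measurable_cst.
apply: preserving_rect.
  apply: measurable_fun_pair; [apply: measurableT_comp (mf a) _; exact: measurable_fst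
                              |apply: measurableT_comp (mf d) _; exact: measurable_snd].
move=> A B mA mB.
rewrite (_ : _ @^-1` _ = ((fun x : RR => (a * x : RR)) @^-1` A) `*` ((fun x : RR =>
    (d * x : RR)) @^-1` B)).
  rewrite /leb2 product_measure1E//; try by rewrite -[X in measurable X]setTI; exact: mf.
  rewrite (leb_scale a0 mA) (leb_scale d0 mB) muleACA -EFinM -normrM ad mul1e//.
by apply/seteqP; split => x [].
Qed.

(** The shear translates every vertical section, so the section lengths are unchanged. *)
Lemma preserving_shear (c : R) : preserving (fun x => (x.1, x.2 + c * x.1)).
Proof.
apply: preserving_rect.
  apply: measurable_fun_pair; first exact: measurable_fst.
  apply: (@measurable_realfun.measurable_funD _ _ _ setT (fun x : RR * RR => x.2));
      first exact: measurable_snd.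
  by apply: measurable_realfun.measurable_funM; [exact: measurable_cst|exact: measurable_fst].
move=> A B mA mB; rewrite -product_measure1E// /leb2 /product_measure1.
apply: eq_integral => x _; rewrite /= /xsection.
have [xA|xA] := pselect (A x).
  rewrite -[RHS](leb_shift (c * x)); last first.
    rewrite (_ : [set _ | _] = B) //; apply/seteqP; split=> y /=; rewrite in_setE; first by case.
    by move=> By; split.
  by congr (leb _); apply/seteqP; split=> y /=; rewrite !in_setE.
by congr (leb _); apply/seteqP; split=> y /=; rewrite !in_setE => -[].
Qed.

(** For nonzero [a], elimination factors the matrix into a lower shear, a diagonal matrix with the
    same determinant and an upper shear, the last being a lower shear between two swaps. For [a = 0]
    the columns are swapped. *)
Lemma preserving_lin2 (a b c d : R) : `|a * d - b * c| = 1 -> preserving (lin2 a b c d).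
Proof.
have key (a' b' c' d' : R) : a' != 0 -> `|a' * d' - b' * c'| = 1 -> preserving (lin2 a' b' c' d').
  move=> a0 e; rewrite (_ : lin2 a' b' c' d' = (fun x => (x.1, x.2 + c' / a' * x.1)) \o
    (fun x => (a' * x.1, (a' * d' - b' * c') / a' * x.2)) \o
    (fun x => (x.2, x.1)) \o (fun x => (x.1, x.2 + b' / a' * x.1)) \o (fun x => (x.2, x.1))).
    apply: preserving_comp preserving_swap; apply: preserving_comp (preserving_shear _).
    apply: preserving_comp preserving_swap; apply: preserving_comp (preserving_shear _) _.
    by apply: preserving_diag; rewrite mulrC divfK.
  by apply/funext => x; apply: pt_eq => /=; field.
move=> e; have [a0|a0] := eqVneq a 0; last exact: key.
rewrite (_ : lin2 a b c d = lin2 b a d c \o (fun x => (x.2, x.1))); last first.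
  by apply/funext => x; apply: pt_eq => /=; ring.
apply: preserving_comp preserving_swap; apply: key.
  by apply: contraTneq (ltr01 : 0 < 1 :> R) => b0; rewrite -e a0 b0 !mul0r subrr normr0 ltxx.
by rewrite -e distrC.
Qed.

End LebesguePlane.

(** * The moment vector *)

Section Moment.
Variable R : realType.
Local Notation pt := (R * R)%type.
Local Notation RR := (measurableTypeR R).
Local Notation leb := (@lebesgue_measure R).
Local Notation leb2 := (@leb2 R).
Implicit Types (P K : set pt).

(** An open set is the union of the countably many rational boxes inside it. This makes closed sets,
    hence polygons, measurable for the product structure. *)
Lemma open_measurable_plane (U : set pt) : open U -> measurable (U : set (RR * RR)).
Proof.
move=> oU.
pose box (q : (rat * rat) * (rat * rat)) : set (RR * RR) :=
  `]ratr q.1.1, ratr q.1.2[%classic `*` `]ratr q.2.1, ratr q.2.2[%classic.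
pose F q : set (RR * RR) := if `[< box q `<=` U >] then box q else set0.
have -> : U = \bigcup_q F q.
  apply/seteqP; split=> [x Ux|x [q _]]; last first.
    by rewrite /F; case: ifPn => // /asboolP; exact.
  have : nbhs x U by exact: open_nbhs_nbhs.
  case: x Ux => x y Ux [[A B] /= [Ax By] AB].
  have /nbhs_ballP[e1 /= e10 eA] := Ax; have /nbhs_ballP[e2 /= e20 eB] := By.
  have /rat_in_itvoo[a] : x - e1 < x by rewrite ltrBlDr ltrDl.
  have /rat_in_itvoo[b] : x < x + e1 by rewrite ltrDl.
  have /rat_in_itvoo[c] : y - e2 < y by rewrite ltrBlDr ltrDl.
  have /rat_in_itvoo[d] : y < y + e2 by rewrite ltrDl.
  rewrite !in_itv /= => /andP[d1 d2] /andP[c1 c2] /andP[b1 b2] /andP[a1 a2].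
  exists ((a, b), (c, d)) => //; rewrite /F; case: asboolP => [_|[]].
    by split => /=; rewrite in_itv /=; apply/andP.
  move=> [u v] [/=]; rewrite !in_itv /= => /andP[u1 u2] /andP[v1 v2].
  apply: AB; split => /=; [apply: eA|apply: eB]; rewrite /ball /= ltr_distlC; apply/andP; split;
      lra.
apply: countable_bigcupT_measurable => [|q]; [exact: countableP|].
rewrite /F; case: ifPn => // _.
by apply: measurableX; exact: measurable_itv.
Qed.

Lemma closed_measurable_plane (U : set pt) : closed U -> measurable (U : set (RR * RR)).
Proof. by move=> /closed_openC/open_measurable_plane/measurableC; rewrite setCK. Qed.

Lemma hull_measurable s : measurable (conv_hull s : set (RR * RR)).
Proof. by apply: closed_measurable_plane; exact: hull_closed. Qed.

Definition box (M : R) : set (RR * RR) := `[- M, M]%classic `*` `[- M, M]%classic.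

Lemma box_measurable M : measurable (box M).
Proof. by apply: measurableX; exact: measurable_itv. Qed.

Lemma box_cvx M : cvx_set (box M).
Proof.
move=> l p q l0 l1 []; rewrite /= !in_itv /= => /andP[p1 p2] /andP[p3 p4] [].
rewrite /= !in_itv /= => /andP[q1 q2] /andP[q3 q4].
have l1' : 0 <= 1 - l by rewrite subr_ge0.
split; rewrite /= in_itv /=; apply/andP; split.
- have := ler_wpM2l l0 p1; have := ler_wpM2l l1' q1; lra.
- have := ler_wpM2l l0 p2; have := ler_wpM2l l1' q2; lra.
- have := ler_wpM2l l0 p3; have := ler_wpM2l l1' q3; lra.
- have := ler_wpM2l l0 p4; have := ler_wpM2l l1' q4; lra.
Qed.

Lemma box_le M N : M <= N -> box M `<=` box N.
Proof.
move=> MN z [] /=; rewrite !in_itv /= => /andP[p1 p2] /andP[p3 p4].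
by split; rewrite /= in_itv /=; apply/andP; split; lra.
Qed.

Lemma leb2_box M : 0 <= M -> leb2 (box M) = ((2 * M) ^+ 2)%:E.
Proof.
move=> M0; rewrite /box /leb2 product_measure1E; try exact: measurable_itv.
rewrite /= !lebesgue_measure_itv /= lte_fin.
case: ifPn => MM; first by rewrite -EFinB -EFinM; congr EFin; ring.
have -> : M = 0 by move: MM; rewrite -leNgt; lra.
by rewrite mulr0 expr0n /= mule0.
Qed.

Lemma hull_bounded s : exists2 M : R, 0 <= M & conv_hull s `<=` box M.
Proof.
suff [M M0 H] : exists2 M : R, 0 <= M & forall p, p \in s -> box M p.
  by exists M => //; apply: hull_min => //; exact: box_cvx.
elim: s => [|a s [M M0 H]]; first by exists 0.
exists (M + `|a.1| + `|a.2|) => [|p]; first by rewrite !addr_ge0.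
rewrite inE => /orP[/eqP->|/H]; last by apply: box_le; rewrite -addrA lerDl addr_ge0.
have := normr_ge0 a.1; have := normr_ge0 a.2 => h1 h2.
by split; rewrite /= in_itv /= -ler_norml; lra.
Qed.

Definition bounded_measurable (P : set (RR * RR)) := measurable P /\ exists2 M, 0 <= M &
    P `<=` box M.

Lemma hull_bm s : bounded_measurable (conv_hull s).
Proof. by split; [exact: hull_measurable|exact: hull_bounded]. Qed.

Lemma fst_integrable (P : set (RR * RR)) : bounded_measurable P ->
  leb2.-integrable P (EFin \o (fun x : RR * RR => x.1 : R)).
Proof.
move=> [mP [M M0 PM]]; apply: measurable_bounded_integrable => //.
- apply: (@le_lt_trans _ _ (leb2 (box M))).
    by apply: le_measure; rewrite ?inE//; exact: box_measurable.
  by rewrite leb2_box// ltry.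
- by apply: measurable_funTS; exact: measurable_fst.
- exists M; split; rewrite ?num_real// => x Mx y Py; have [+ _] := PM _ Py.
  by rewrite /= in_itv /= -ler_norml => /le_trans; apply; exact: ltW.
Qed.

Lemma snd_integrable (P : set (RR * RR)) : bounded_measurable P ->
  leb2.-integrable P (EFin \o (fun x : RR * RR => x.2 : R)).
Proof.
move=> [mP [M M0 PM]]; apply: measurable_bounded_integrable => //.
- apply: (@le_lt_trans _ _ (leb2 (box M))).
    by apply: le_measure; rewrite ?inE//; exact: box_measurable.
  by rewrite leb2_box// ltry.
- by apply: measurable_funTS; exact: measurable_snd.
- exists M; split; rewrite ?num_real// => x Mx y Py; have [_ +] := PM _ Py.
  by rewrite /= in_itv /= -ler_norml => /le_trans; apply; exact: ltW.
Qed.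

Lemma bmU P K : bounded_measurable P -> bounded_measurable K -> bounded_measurable (P `|` K).
Proof.
move=> [mP [M M0 PM]] [mK [N N0 KN]]; split; first exact: measurableU.
exists (M + N); first exact: addr_ge0.
by move=> x [/PM|/KN]; apply: box_le; rewrite ?lerDl ?lerDr.
Qed.

Lemma Rintegral_UI P K (f : RR * RR -> R) : bounded_measurable P -> bounded_measurable K ->
  leb2.-integrable P (EFin \o f) -> leb2.-integrable K (EFin \o f) ->
  leb2.-integrable (P `|` K) (EFin \o f) ->
  Rintegral leb2 (P `|` K) f + Rintegral leb2 (P `&` K) f =
  Rintegral leb2 P f + Rintegral leb2 K f.
Proof.
move=> [mP _] [mK _] iP iK iPK.
have E1 : P `|` K = P `|` (K `\` P).
  by apply/seteqP; split=> x [Px|]; [left|case: (pselect (P x)); [left|right]|left|move=> [];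
      right].
have E2 : K = (P `&` K) `|` (K `\` P).
  by apply/seteqP; split=> x; [case: (pselect (P x)); [left|right]|move=> [] []].
have mKP : measurable (K `\` P : set (RR * RR)) by exact: measurableD.
have mPK : measurable (P `&` K : set (RR * RR)) by exact: measurableI.
rewrite E1 Rintegral_setU -?E1//; last first.
  by apply/disj_setPS => x [? []].
rewrite [X in _ = _ + Rintegral _ X _]E2 Rintegral_setU -?E2//; last first.
  by apply/disj_setPS => x [[? ?] []].
by rewrite -addrA; congr (_ + _); rewrite addrC.
Qed.

Lemma moment_valuation : is_valuation (@moment R).
Proof.
move=> K Q [[s ->] _] [[t ->] _] _ _.
have bs := hull_bm s; have bt := hull_bm t; have bu := bmU bs bt.
by split; apply: Rintegral_UI => //; do ?exact: fst_integrable; exact: snd_integrable.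
Qed.

(** Change of variables: [leb2] is its own image under the map, which is injective since its
    determinant is not 0. *)
Lemma Rintegral_lin2 (a b c d : R) s (f : RR * RR -> R) : `|a * d - b * c| = 1 ->
  measurable_fun setT f -> leb2.-integrable (conv_hull s) (EFin \o (f \o lin2 a b c d)) ->
  Rintegral leb2 (lin2 a b c d @` conv_hull s) f = Rintegral leb2 (conv_hull s) (f \o lin2 a b c d).
Proof.
move=> e mf intf; have [mL pL] := preserving_lin2 e.
have Lpre : lin2 a b c d @^-1` (lin2 a b c d @` conv_hull s) = conv_hull s.
  apply/seteqP; split=> [x [y sy yx]|x sx]; last by exists x.
  suff -> : x = y by [].
  have d0 : a * d - b * c != 0 by rewrite -normr_eq0 e oner_eq0.
  case: x y yx {sy} => x1 x2 [y1 y2] [h1 h2].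
  have k1 : (a * d - b * c) * (y1 - x1) = 0.
    rewrite [LHS](_ : _ = d * ((a * y1 + b * y2) - (a * x1 + b * x2)) - b * ((c * y1 +
        d * y2) - (c * x1 + d * x2))); last by ring.
    by rewrite h1 h2 !subrr !mulr0 subrr.
  have k2 : (a * d - b * c) * (y2 - x2) = 0.
    rewrite [LHS](_ : _ = a * ((c * y1 + d * y2) - (c * x1 + d * x2)) - c * ((a * y1 +
        b * y2) - (a * x1 + b * x2))); last by ring.
    by rewrite h1 h2 !subrr !mulr0 subrr.
  move/eqP: k1; move/eqP: k2; rewrite !mulf_eq0 (negbTE d0) /= !subr_eq0 => /eqP-> /eqP->.
  by [].
have mI : measurable (lin2 a b c d @` conv_hull s : set (RR * RR)).
  by rewrite lin2_hull; exact: hull_measurable.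
rewrite /Rintegral; congr fine.
transitivity (\int[measure_function_pushforward__canonical__measure_function_Measure leb2 mL]_(y in lin2 a b c d @` conv_hull s) (f y)%:E)%E.
  by apply: eq_measure_integral => A mA _; apply/esym; exact: pL.
rewrite (@integral_pushforward _ _ _ _ _ _ mL leb2 _ (EFin \o f)).
- by rewrite Lpre.
- exact/measurable_realfun.measurable_EFinP.
- by rewrite Lpre.
- exact: mI.
Qed.

Lemma moment_covariant : covariant (@moment R).
Proof.
move=> a b c d P dE [[s ->] _].
have e : `|a * d - b * c| = 1 by case: dE => ->; rewrite ?normrN normr1.
have bm := hull_bm s; have [mP _] := bm.
have i1 := fst_integrable bm; have i2 := snd_integrable bm.
have iZ (k : R) (f : RR * RR -> R) : leb2.-integrable (conv_hull s) (EFin \o f) ->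
    leb2.-integrable (conv_hull s) (EFin \o (fun x => k * f x)).
  move=> fi; rewrite (_ : _ \o _ = (fun x => k%:E * (EFin \o f) x)%E); first exact: integrableZl.
  by apply/funext => x /=; rewrite EFinM.
have lin2 (k l : R) : leb2.-integrable (conv_hull s) (EFin \o (fun x : RR * RR => k * x.1 +
    l * x.2)) /\
    Rintegral leb2 (conv_hull s) (fun x => k * x.1 + l * x.2) =
    k * (moment (conv_hull s)).1 + l * (moment (conv_hull s)).2.
  split.
    rewrite (_ : _ \o _ = (EFin \o (fun x : RR * RR => k * x.1)%R) \+
        (EFin \o (fun x : RR * RR => l * x.2)%R))%E.
      by apply: integrableD => //; exact: iZ.
    by apply/funext => x /=; rewrite EFinD.
  rewrite (@RintegralD _ _ _ _ _ (fun x : RR * RR => k * x.1) (fun x : RR * RR => l * x.2))//;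
      try exact: iZ.
  by rewrite /moment /= !RintegralZl.
have [j1 k1] := lin2 a b; have [j2 k2] := lin2 c d.
apply: pt_eq; rewrite [LHS]Rintegral_lin2//.
- exact: measurable_fst.
- exact: measurable_snd.
Qed.

End Moment.

(** * Unit caps *)

Section UnitCaps.
Variable R : realType.
Local Notation pt := (R * R)%type.
Local Notation RR := (measurableTypeR R).
Local Notation leb := (@lebesgue_measure R).
Local Notation leb2 := (@leb2 R).
Implicit Types (P K : set pt) (mu : set pt -> pt).

(** The difference [f] of [g] and the linear function is additive and vanishes at [r], so it is
    [r]-periodic and bounded on all positive reals. As [f (n t)] is n times [f t], it must be 0. *)
Lemma additive_bounded_linear (g : R -> R) (d M : R) :
  (forall s t, 0 < s -> 0 < t -> g (s + t) = g s + g t) ->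
  0 < d -> (forall t, 0 < t -> t < d -> `|g t| <= M) ->
  forall t, 0 < t -> g t = g 1 * t.
Proof.
move=> gD d0 gM.
have gn n t : 0 < t -> g (n.+1%:R * t) = n.+1%:R * g t.
  move=> t0; elim: n => [|n IH]; first by rewrite !mul1r.
  by rewrite -[n.+2%:R]natr1 !mulrDl !mul1r gD// ?IH// mulr_gt0.
(* [r] is the reciprocal of a natural number, which forces [f r = 0], and is smaller than [d], where
   the bound is known. *)
set N := Num.bound d^-1; set r : R := (N.+1%:R)^-1.
have r0 : 0 < r by rewrite invr_gt0.
have rd : r < d.
  rewrite /r invf_plt ?posrE// (lt_trans (archi_boundP _)) ?invr_ge0 ?ltr_nat//; exact: ltW.
pose f t := g t - g 1 * t.
have fD s t : 0 < s -> 0 < t -> f (s + t) = f s + f t.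
  by move=> s0 t0; rewrite /f gD//; ring.
have fr : f r = 0.
  have := gn N r r0; rewrite /f divff// => ->.
  by rewrite mulrC mulrA mulVf// mul1r subrr.
have M0 : 0 <= M + `|g 1| * d.
  rewrite addr_ge0 ?mulr_ge0 ?(ltW d0)//.
  exact: le_trans (gM r r0 rd).
have fM n t : 0 < t -> t <= n%:R * r -> `|f t| <= M + `|g 1| * d.
  elim: n t => [t t0|n IH t t0 tn]; first by rewrite mul0r leNgt t0.
  have [tr|rt] := leP t r.
    rewrite /f (le_trans (ler_normB _ _))// lerD ?gM//; first exact: le_lt_trans rd.
    rewrite normrM ler_wpM2l// gtr0_norm//; apply: ltW; exact: le_lt_trans rd.
  have tr0 : 0 < t - r by rewrite subr_gt0.
  rewrite -(subrK r t) fD// fr addr0 IH//.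
  by move: tn; rewrite -natr1 mulrDl mul1r lerBlDr.
have fM' t : 0 < t -> `|f t| <= M + `|g 1| * d.
  move=> t0; apply: (fM (Num.bound (t / r))) => //.
  by rewrite -ler_pdivrMr// ltW// archi_boundP// divr_ge0// ltW.
move=> t t0; apply/eqP; rewrite -subr_eq0 -/(f t) -normr_eq0 eq_le normr_ge0 andbT.
rewrite leNgt; apply/negP => ft.
set n := Num.bound ((M + `|g 1| * d) / `|f t|).
have := fM' (n.+1%:R * t) (mulr_gt0 _ t0); rewrite ltr0Sn => /(_ isT).
rewrite (_ : f (n.+1%:R * t) = n.+1%:R * f t); last by rewrite /f gn//; ring.
rewrite normrM normr_nat leNgt => /negP; apply.
rewrite -ltr_pdivrMr// (lt_trans (archi_boundP _)) ?ltr_nat//.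
by rewrite divr_ge0.
Qed.

Local Notation e1 := ((1, 0) : pt).
Local Notation e2 := ((0, 1) : pt).
Local Notation v0 := ((-1, -1) : pt).

Section Form.
Variable mu : set pt -> pt.
Hypotheses (mu_val : is_valuation mu) (mu_cov : covariant mu).
Local Notation C := (cap_val mu).
Let Cu t := C e1 e2 (- t, 1).

(** The point [(- s, 1)] lies on the side from [e2] to [(- (s + t), 1)], so one face of the
    tetrahedron is flat. The shear fixing [e1] and taking [e2] to [(- s, 1)] maps the cap of
    parameter [t] onto the second piece. *)
Let Cu_cocycle s t : 0 < s -> 0 < t -> Cu (s + t) = Cu s + lin2 1 (- s) 0 1 (Cu t).
Proof.
move=> s0 t0; rewrite /Cu -C_cov//; [|by ring|exact: cap_triple_unit].
have -> : lin2 1 (- s) 0 1 e1 = e1 by apply: pt_eq => /=; ring.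
have -> : lin2 1 (- s) 0 1 e2 = (- s, 1) by apply: pt_eq => /=; ring.
have -> : lin2 1 (- s) 0 1 (- t, 1) = (- (s + t), 1) by apply: pt_eq => /=; ring.
have c1 : cap_triple e1 e2 (- s, 1) by exact: cap_triple_unit.
have c2 : cap_triple e1 (- s, 1) (- (s + t), 1) by split; rewrite /orient /cross /=; lra.
have c3 : cap_triple e2 (- s, 1) (- (s + t), 1) by split; rewrite /orient /cross /=; lra.
have c4 : cap_triple e1 e2 (- (s + t), 1) by apply: cap_triple_unit; exact: addr_gt0.
rewrite (C_cocycle mu_val c1 c2 c3 c4) (C_flat _ c3) ?add0r//.
by rewrite /orient /=; ring.
Qed.

Let h := (Cu 1).2.

(** Linearity of the second coordinate comes from exchanging the two parameters in the first formula
    and setting one of them to 1. *)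
Lemma unit_cap_cocycle :
  (forall s t, 0 < s -> 0 < t -> (Cu (s + t)).1 = (Cu s).1 + (Cu t).1 - s * (Cu t).2) /\
  (forall t, 0 < t -> (Cu t).2 = h * t).
Proof.
have GD s t : 0 < s -> 0 < t -> (Cu (s + t)).1 = (Cu s).1 + (Cu t).1 - s * (Cu t).2.
  by move=> s0 t0; rewrite Cu_cocycle//=; ring.
split=> // t t0; have := GD _ _ t0 ltr01; have := GD _ _ (ltr01 : 0 < 1 :> R) t0.
by rewrite addrC /h => -> ?; lra.
Qed.

(** Adding h t^2 / 2 to the first coordinate absorbs the term - h s t and leaves an additive
    function [g]. The reflection that exchanges [e1] and [(-1, 1)] and fixes [e2] shows
    [(Cu 1).1 = 0], so [g 1] is h / 2. *)
Lemma unit_cap_form : (exists2 d : R, 0 < d & exists M, forall t, 0 < t -> t < d ->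
    `|(Cu t).1| <= M) ->
  forall t, 0 < t -> Cu t = (h * t / 2 - h * t ^+ 2 / 2, h * t).
Proof.
move=> [d d0 [M HM]].
have [GD HE] := unit_cap_cocycle.
have G1 : (Cu 1).1 = 0.
  have := C_refl (a := -1) (b := 0) (c := 1) (d :=
      1) mu_cov _ (cap_triple_unit (ltr01 : 0 < 1 :> R)).
  have -> : lin2 (-1) 0 1 1 e1 = (-1, 1) by apply: pt_eq => /=; ring.
  have -> : lin2 (-1) 0 1 1 e2 = e2 by apply: pt_eq => /=; ring.
  have -> : lin2 (-1) 0 1 1 (-1, 1) = e1 by apply: pt_eq => /=; ring.
  move=> K; have /(congr1 fst) /= : Cu 1 = lin2 (-1) 0 1 1 (Cu 1) by apply: K; ring.
  lra.
pose g t := (Cu t).1 + h * t ^+ 2 / 2.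
have gD s t : 0 < s -> 0 < t -> g (s + t) = g s + g t.
  by move=> s0 t0; rewrite /g GD// HE//; field.
have gM t : 0 < t -> t < d -> `|g t| <= M + `|h| * d ^+ 2 / 2.
  move=> t0 td; rewrite (le_trans (ler_normD _ _))// lerD ?HM//.
  have tt : t * t <= d * d by apply: ler_pM => //; exact: ltW.
  rewrite -!mulrA normrM ler_wpM2l// ger0_norm; first by lra.
  by rewrite !mulr_ge0 ?invr_ge0// ltW.
move=> t t0; apply: pt_eq; last exact: HE.
have := additive_bounded_linear gD d0 gM t0.
by rewrite /g G1 add0r expr1n => K; rewrite [RHS]/=; lra.
Qed.

(** One third vertex [v0] serves for all [t], so the two polygons move with [t] through a single
    vertex only. *)
Lemma unit_cap_eq t : 0 < t -> Cu t =
  mu (conv_hull [:: (- t, 1); e2; e1; v0]) - mu (conv_hull [:: (- t, 1); e1; v0]).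
Proof.
move=> t0; have P0 : Po (conv_hull [:: e1; (- t, 1); v0]).
  by apply: tri_Po; rewrite /cross /=; lra.
rewrite (_ : conv_hull [:: (- t, 1); e1; v0] = conv_hull [:: e1; (- t, 1); v0]); last first.
  by apply: hull_eq => z; rewrite !inE orbCA.
rewrite (_ : conv_hull [:: (- t, 1); e2; e1; v0] = conv_hull [:: e2; e1; (- t, 1); v0]); last first.
  by apply: hull_eq => z; rewrite !inE orbCA; congr orb; rewrite orbCA.
rewrite (@cap_add _ _ mu_val e1 e2 (- t, 1) [:: e1; (- t, 1); v0])//.
- by rewrite [RHS]addrAC subrr add0r.
- exact: cap_triple_unit.
- by apply: hull_mem; rewrite !inE eqxx ?orbT.
- by apply: hull_mem; rewrite !inE eqxx ?orbT.
- by move=> z; rewrite !inE => /or3P[] /eqP->; split; rewrite /orient /=; lra.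
Qed.

End Form.

Lemma box_norm (M : R) (z : RR * RR) : box M z -> `|z.1 : R| <= M /\ `|z.2 : R| <= M.
Proof. by move=> [h1 h2]; move: h1 h2; rewrite /= !in_itv /= -!ler_norml. Qed.

Lemma moment_bound P : bounded_measurable P -> P `<=` box 1 -> `|(moment P).1| <= 4.
Proof.
move=> bm P1; have [mP _] := bm; have iP := fst_integrable bm.
have fin : (leb2 P <= 4%:E)%E.
  rewrite (_ : 4 = (2 * 1) ^+ 2 :> R) -?leb2_box//; last by ring.
  by apply: le_measure; rewrite ?inE//; exact: box_measurable.
rewrite (le_trans (le_normr_Rintegral mP iP))//.
rewrite -lee_fin /Rintegral fineK.
  apply: le_trans fin; rewrite -[leRHS]mul1e -integral_cst//.
  apply: ge0_le_integral => //.
  - apply/measurable_realfun.measurable_EFinP; apply: measurableT_comp => //.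
    by apply: measurable_funTS; exact: measurable_fst.
  - by move=> x /P1/box_norm[]; rewrite lee_fin.
by apply: integrable_fin_num => //; exact: (integrable_norm iP).
Qed.

(** For t < 1 both polygons of [unit_cap_eq] lie in [box 1], whose area is 4; each contributes at
    most 4. *)
Lemma moment_unit_bounded : forall t : R, 0 < t -> t < 1 ->
  `|(cap_val (@moment R) e1 e2 (- t, 1)).1| <= 8.
Proof.
move=> t t0 t1; rewrite unit_cap_eq//; last exact: moment_valuation.
have b1 l : all (fun p : pt => (`|p.1| <= 1) && (`|p.2| <= 1)) l -> conv_hull l `<=` box 1.
  move=> /allP H; apply: hull_min; first exact: box_cvx.
  by move=> p /H/andP[p1 p2]; split; rewrite /= in_itv /= -ler_norml.
have nt : `|- t| <= 1 by rewrite normrN gtr0_norm// ltW.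
rewrite (le_trans (ler_normB _ _))// (_ : 8 = 4 + 4 :> R); last by ring.
by apply: lerD; apply: moment_bound; try exact: hull_bm; apply: b1;
  rewrite /= nt ?normrN ?normr1 ?normr0 ?lexx ?ler01.
Qed.

(** The value is the integral of the height over [K] minus [Q]. This region lies in the upper
    half-plane and contains a box on which the height exceeds 1/2. *)
Lemma moment_unit_pos : 0 < (cap_val (@moment R) e1 e2 (-1, 1)).2.
Proof.
rewrite (unit_cap_eq (@moment_valuation R) (ltr01 : 0 < 1 :> R)) /=.
set K := conv_hull _; set Q := conv_hull _.
have [mK _] : bounded_measurable K := hull_bm _; have [mQ _] : bounded_measurable Q := hull_bm _.
have iK : leb2.-integrable K (EFin \o (fun x : RR * RR => x.2 : R)) by apply: snd_integrable;
    exact: hull_bm.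
(* Any box inside the triangle [e1], [e2], [(-1, 1)] and strictly above the line x + 2 y = 1, which
   bounds [Q], would do. *)
pose B : set (RR * RR) := `[- (1/20), 1/20]%classic `*` `[3/5, 7/10]%classic.
have mB : measurable B by apply: measurableX; exact: measurable_itv.
have QK : Q `<=` K by apply: hull_sub => p; rewrite !inE => /or3P[]->; rewrite ?orbT.
have Qline z : Q z -> 0 <= orient e1 (-1, 1) z.
  by apply: hull_halfplane => a; rewrite !inE => /or3P[] /eqP->; rewrite /orient /=; lra.
have Kup z : K z -> ~ Q z -> 0 <= z.2.
  have -> : K = conv_hull [:: e2; e1; (-1, 1)] `|` Q.
    rewrite /K /Q (_ : conv_hull [:: (- 1, 1); e1; v0] = conv_hull [:: e1; (- 1, 1); v0]);
        last first.
      by apply: hull_eq => z'; rewrite !inE orbCA.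
    rewrite (_ : conv_hull [:: (- 1, 1); e2; e1; v0] = conv_hull [:: e2; e1; (- 1, 1); v0]);
        last first.
      by apply: hull_eq => z'; rewrite !inE orbCA; congr orb; rewrite orbCA.
    apply: hull_add.
    - by rewrite /orient /=; lra.
    - by apply: hull_mem; rewrite !inE eqxx ?orbT.
    - by apply: hull_mem; rewrite !inE eqxx ?orbT.
    - by move=> a; rewrite !inE => /or3P[] /eqP->; rewrite /orient /=; lra.
    - by move=> a; rewrite !inE => /or3P[] /eqP->; rewrite /orient /=; lra.
  move=> [Tz _|//]; apply: (hull_min (@cvx_above R 0)) Tz => a.
  by rewrite !inE => /or3P[] /eqP->; rewrite /=; lra.
have BK : B `<=` K `\` Q.
  move=> [x y] [/=]; rewrite !in_itv /= => /andP[x1 x2] /andP[y1 y2]; split; last first.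
    by move=> /Qline; rewrite /orient /=; lra.
  have c1 : conv_hull [:: (-1, 1); e2; e1; v0] e1 by apply: hull_mem; rewrite !inE eqxx ?orbT.
  have c2 : conv_hull [:: (-1, 1); e2; e1; v0] e2 by apply: hull_mem; rewrite !inE eqxx ?orbT.
  have c3 : conv_hull [:: (-1, 1); e2; e1; v0] (-1, 1) by apply: hull_mem; rewrite !inE eqxx ?orbT.
  apply: (tri_mem (@hull_convex _ _) c1 c2 c3); rewrite /orient /=; lra.
have mKQ : measurable (K `\` Q : set (RR * RR)) by exact: measurableD.
have mKQB : measurable ((K `\` Q) `\` B : set (RR * RR)) by exact: measurableD.
have E1 : K = Q `|` (K `\` Q) by apply/seteqP; split=> x; [case: (pselect (Q x));
    [left|right]|move=> [/QK|[]]].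
have E2 : K `\` Q = B `|` ((K `\` Q) `\` B).
  by apply/seteqP; split=> x; [case: (pselect (B x)); [left|right]|move=> [/BK|[]]].
have iKQ : leb2.-integrable (K `\` Q) (EFin \o (fun x : RR * RR => x.2 : R)).
  by apply: (integrableS mK) => // x [].
rewrite {1}E1 Rintegral_setU -?E1//; last by apply/disj_setPS => x [? []].
rewrite addrAC subrr add0r {1}E2 Rintegral_setU -?E2//; last by apply/disj_setPS => x [? []].
apply: ltr_wpDr; first by apply: Rintegral_ge0 => x [[Kx Qx] _]; exact: (Kup x Kx Qx).
have iB : leb2.-integrable B (EFin \o (fun x : RR * RR => x.2 : R)).
  by apply: (integrableS mK) => // x /BK[].
have lB : leb2 B = ((1/10) * (1/10))%:E.
  rewrite /B /leb2 product_measure1E; try exact: measurable_itv.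
  rewrite /= !lebesgue_measure_itv /= !lte_fin !ifT; [|by lra..].
  by rewrite -!EFinB -EFinM; congr EFin; field.
have iC : leb2.-integrable B (EFin \o (fun _ : RR * RR => 1/2 : R)).
  apply: measurable_bounded_integrable => //; first by change (leb2 B < +oo)%E; rewrite lB ltry.
  by exists `|1/2 : R|; split; [exact: num_real|move=> x Mx y _; exact: ltW].
apply: (@lt_le_trans _ _ (Rintegral leb2 B (fun=> 1/2))).
  rewrite Rintegral_cst// [X in fine X](_ : _ = leb2 B)// lB /=; lra.
apply: le_Rintegral => // -[x y] [_] /=; rewrite in_itv /= => /andP[]; lra.
Qed.

End UnitCaps.

(** * Measurability *)

Section Measurability.
Variable R : realType.
Local Notation pt := (R * R)%type.
Local Notation RR := (measurableTypeR R).
Local Notation leb := (@lebesgue_measure R).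
Implicit Types (P K : set pt) (mu : set pt -> pt).
Local Notation e1 := ((1, 0) : pt).
Local Notation e2 := ((0, 1) : pt).
Local Notation v0 := ((-1, -1) : pt).

(* Steinhaus's argument: a set filling more than 3/4 of the unit interval meets
   each of its translates by less than 1/4. *)
Lemma close_pair (A : (set RR)^nat) : (forall n, measurable (A n)) ->
  nondecreasing_seq A -> \bigcup_n A n = `]0, 1[%classic ->
  exists n, forall s : R, 0 < s -> s < 1/4 -> exists2 t, A n t & A n (t + s).
Proof.
move=> mA ndA UA.
have [n An] : exists n, ((3/4)%:E < leb (A n))%E.
  apply: contrapT => H.
  have cv : (leb \o A @ \oo --> leb (\bigcup_n A n))%E.
    by apply: nondecreasing_cvg_mu => //; exact: bigcup_measurable.
  have : (leb (\bigcup_n A n) <= (3/4)%:E)%E.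
    rewrite -(cvg_lim _ cv)//; apply: lime_le; first by apply/cvg_ex; exists (leb (\bigcup_n A n)).
    by apply: nearW => n /=; rewrite leNgt; apply/negP => h; apply: H; exists n.
  by rewrite UA lebesgue_measure_itv /= lte_fin ltr01 -EFinB lee_fin; lra.
exists n => s s0 s1; apply: contrapT => H.
pose A' : set RR := (fun x : RR => (x + s : RR)) @^-1` A n.
have A01 : A n `<=` `]0, 1[%classic by rewrite -UA => x Ax; exists n.
have mA' : measurable A'.
  rewrite -[A']setTI; apply: (_ : measurable_fun setT (fun x : RR => x + s : RR)) => //.
  by apply: measurable_realfun.measurable_funD => //; exact: measurable_cst.
have lA' : leb A' = leb (A n) by exact: leb_shift.
have lU : leb (A n `|` A') = (leb (A n) + leb (A n))%E.
  rewrite measureU//; first by congr (_ + _)%E; exact: lA'.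
  by apply/seteqP; split=> // x [Ax A'x]; apply: H; exists x.
(* Otherwise two disjoint copies of total length above 3/2 would lie in an interval of length
   5/4. *)
have : (leb (A n `|` A') <= leb (`](- (1/4))%R, 1%R[%classic : set RR))%E.
  apply: le_measure; rewrite ?inE; [exact: measurableU|exact: measurable_itv|].
  by move=> x [/A01|/A01]; rewrite /= !in_itv /= => /andP[a b]; apply/andP; split; lra.
rewrite lU lebesgue_measure_itv /= lte_fin ifT; last by lra.
rewrite -EFinB; move: An; case: (leb (A n)) => [r| |] //=.
  by rewrite lte_fin -EFinD lee_fin; lra.
Qed.

Lemma edist_mix l (a b c : pt) : Defs.edist (mix l a c) (mix l b c) = `|l| * Defs.edist a b.
Proof.
rewrite /Defs.edist -sqrtr_sqr -sqrtrM ?sqr_ge0//; congr Num.sqrt => /=; ring.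
Qed.

Lemma edistC (a b : pt) : Defs.edist a b = Defs.edist b a.
Proof. by rewrite /Defs.edist; congr Num.sqrt; ring. Qed.

(** Replacing [a] by [b] in a mixture with weight [k] moves the point by [k] times their
    distance. *)
Lemma hausdorff_hull (a b c : pt) (l : seq pt) : hausdorff_le
  (conv_hull [:: a, c & l]) (conv_hull [:: b, c & l]) (Defs.edist a b).
Proof.
have H (x y : pt) z : conv_hull [:: x, c & l] z ->
    exists2 z', conv_hull [:: y, c & l] z' & Defs.edist z z' <= Defs.edist x y.
  rewrite !(hull_cons _ (mem_head c l)) => -[k [_ [q [k0 k1 -> Qq ->]]]].
  exists (mix k y q); first by exists k, y, q.
  by rewrite edist_mix ger0_norm// ler_piMl// sqrtr_ge0.
split=> [x /(H a b)[y Py h]|y /(H b a)[x Px h]]; first by exists y.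
by exists x; split=> //; rewrite edistC [leRHS]edistC.
Qed.

(** The sets with measurable preimage under the path form a sigma-algebra relative to [Po], and they
    include the open ones because the path does not increase distances. *)
Lemma path_measurable (P : R -> set pt) (X : set (set pt)) :
  (forall t, 0 < t -> Po (P t)) ->
  (forall s t, 0 < s -> 0 < t -> hausdorff_le (P s) (P t) `|s - t|) ->
  Po_borel X -> measurable ([set t | 0 < t /\ X (P t)] : set RR).
Proof.
move=> PP PH; pose G : set (set (set pt)) :=
  [set X | measurable ([set t | 0 < t /\ X (P t)] : set RR)].
have mpos : measurable ([set t | 0 < t] : set RR).
  rewrite (_ : [set t | _] = [set` `]0, +oo[]); first exact: measurable_itv.
  by apply/seteqP; split=> t /=; rewrite in_itv /= andbT.
apply: (@smallest_sub _ _ _ G); first split.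
- rewrite /G /= (_ : [set t | _] = set0); first exact: measurable0.
  by apply/seteqP; split=> // t [].
- move=> A mA; rewrite /G /= (_ : [set t | _] = [set t | 0 < t] `\` [set t | 0 < t /\ A (P t)]).
    exact: measurableD.
  apply/seteqP; split=> [t [t0 [_ nA]]|t [/= t0 nA]]; first by split=> // -[].
  by split=> //; split; [exact: PP|move=> At; exact: nA].
- move=> A mA; rewrite /G /= (_ : [set t | _] = \bigcup_n [set t | 0 < t /\ A n (P t)]).
    exact: bigcupT_measurable.
  by apply/seteqP; split=> [t [t0 [n _ At]]|t [n _ [t0 At]]]; [exists n|split=> //; exists n].
- move=> U [_ oU]; rewrite /G /=; apply: measurable_realfun.open_measurable.
  rewrite openE => t [t0 Ut]; have [e [e0 He]] := oU _ Ut.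
  apply/nbhs_ballP; exists (Num.min e t) => /=; first by rewrite lt_min e0.
  move=> s; rewrite /ball /= lt_min => /andP[tse tst].
  have s0 : 0 < s by move: tst; rewrite ltr_distlC => /andP[]; lra.
  split=> //; apply: He; first exact: PP.
  have [H1 H2] := PH t s t0 s0.
  split=> [x /H1[y [? h]]|y /H2[x [? h]]]; [exists y|exists x]; split=> //; apply: le_trans h _;
      exact: ltW.
Qed.

Lemma edist_shift (s t : R) : Defs.edist (- s, 1) (- t, 1) = `|s - t|.
Proof. by rewrite /Defs.edist /= subrr expr0n addr0 sqrtr_sqr opprK addrC distrC. Qed.

(** The sets [A n] of parameters at which [mu] is bounded by n on both polygons exhaust the unit
    interval. By [close_pair] some n is such that every s < 1/4 is a difference of two members t and
    t + s of [A n]; the cocycle formula then bounds the first coordinate at s by 2 n + 2 n plus the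
    size of t h s. *)
Lemma measurable_unit_bounded mu : Po_measurable mu -> is_valuation mu -> covariant mu ->
  exists2 d : R, 0 < d & exists M, forall t, 0 < t -> t < d ->
    `|(cap_val mu e1 e2 (- t, 1)).1| <= M.
Proof.
move=> mm mu_val mu_cov.
pose P t := conv_hull [:: (- t, 1); e2; e1; v0] : set pt.
pose Q t := conv_hull [:: (- t, 1); e1; v0] : set pt.
have QP t : Q t `<=` P t by apply: hull_sub => p; rewrite !inE => /or3P[]->; rewrite ?orbT.
have PQ t : 0 < t -> Po (Q t).
  move=> t0; rewrite /Q (_ : conv_hull _ = conv_hull [:: e1; (- t, 1); v0]).
    by apply: tri_Po; rewrite /cross /=; lra.
  by apply: hull_eq => z; rewrite !inE orbCA.
have PP t : 0 < t -> Po (P t) by move=> t0; exact: Po_sup (PQ t t0) (QP t).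
pose B n : set pt := [set x | `|x.1| <= n%:R].
have mB n : measurable (B n).
  rewrite (_ : B n = setT `&` fst @^-1` `[- n%:R, n%:R]%classic).
    by apply: measurable_fst => //; exact: measurable_itv.
  by rewrite setTI; apply/seteqP; split=> x; rewrite /B /= in_itv /= ler_norml.
pose A n : set RR := `]0, 1[%classic `&` ([set t | 0 < t /\ (@Po R `&` mu @^-1` B n) (P t)] `&`
   [set t | 0 < t /\ (@Po R `&` mu @^-1` B n) (Q t)]).
have mA n : measurable (A n).
  apply: measurableI; first exact: measurable_itv.
  apply: measurableI; apply: path_measurable => //; try exact: mm.
    by move=> s t _ _; rewrite -edist_shift; exact: hausdorff_hull.
  by move=> s t _ _; rewrite -edist_shift; exact: hausdorff_hull.
have BS m n : (m <= n)%N -> B m `<=` B n.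
  by move=> mn x; rewrite /B /= => /le_trans; apply; rewrite ler_nat.
have ndA : nondecreasing_seq A.
  move=> m n mn; apply/subsetPset => t [t01 [[t0 [P1 P2]] [_ [Q1 Q2]]]].
  by split=> //; split; split=> //; split=> //; apply: (BS m n).
have UA : \bigcup_n A n = `]0, 1[%classic.
  apply/seteqP; split=> [t [n _ []]//|t t01].
  have t0 : 0 < t by move: t01; rewrite /= in_itv /= => /andP[].
  exists (Num.bound (`|(mu (P t)).1| + `|(mu (Q t)).1|)) => //; split=> //.
  have h : `|(mu (P t)).1| + `|(mu (Q t)).1| <= (Num.bound (`|(mu (P t)).1| + `|(mu (Q t)).1|))%:R.
    by apply: ltW; apply: archi_boundP; exact: addr_ge0.
  split; split=> //; split; [exact: PP| |exact: PQ|];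
    by apply: le_trans h; rewrite ?lerDl ?lerDr.
have [n Hn] := close_pair mA ndA UA.
set h := (cap_val mu e1 e2 (-1, 1)).2.
have CE t : 0 < t -> cap_val mu e1 e2 (- t, 1) = mu (P t) - mu (Q t) by exact: unit_cap_eq.
have CM t : A n t -> `|(cap_val mu e1 e2 (- t, 1)).1| <= n%:R + n%:R.
  move=> [_ [[t0 [_ P2]] [_ [_ Q2]]]]; rewrite CE//=.
  by rewrite (le_trans (ler_normB _ _))// lerD.
have [Cc HE] := unit_cap_cocycle mu_val mu_cov.
exists (1/4); first by lra.
exists (4 * n%:R + `|h|) => s s0 s4.
have [t At Ats] := Hn s s0 s4.
have t01 : 0 < t /\ t < 1 by case: At => + _; rewrite /= in_itv /= => /andP.
have [t0 t1] := t01.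
have := CM _ At; have := CM _ Ats; rewrite (Cc _ _ t0 s0) (HE _ s0) -/h.
have : `|t * (h * s)| <= `|h|.
  rewrite mulrCA normrM ler_piMr// ger0_norm; first by apply: mulr_ile1; lra.
  by apply: mulr_ge0; exact: ltW.
rewrite !ler_norml => /andP[a1 a2] /andP[b1 b2] /andP[c1 c2]; apply/andP; split; lra.
Qed.

End Measurability.

Theorem theorem3p8 (R : realType) (mu : set (R * R) -> R * R) :
  Po_measurable mu -> is_valuation mu -> VL2_covariant mu ->
  exists k : R, forall P, Po P ->
    mu P = (k * (moment P).1, k * (moment P).2).
Proof.
move=> mm mu_val /VL2_covariantP mu_cov.
have Fmu := unit_cap_form mu_val mu_cov (measurable_unit_bounded mm mu_val mu_cov).
have Fm := unit_cap_form (@moment_valuation R) (@moment_covariant R)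
  (ex_intro2 _ _ 1 ltr01 (ex_intro _ 8 (@moment_unit_bounded R))).
set h := (cap_val mu _ _ _).2 in Fmu; set h' := (cap_val (@moment R) _ _ _).2 in Fm.
have h'0 : 0 < h' := moment_unit_pos R.
(* By [unit_cap_form] the unit cap values of [mu] and of the moment vector are the same function of
   t up to the factors [h] and [h'], so this [k] makes those of [nu] vanish. *)
pose k := h / h'; exists k.
pose nu P := mu P - (k * (moment P).1, k * (moment P).2).
have nu_val : is_valuation nu.
  move=> K Q PK PQ PU PI; have [m1 m2] := mu_val K Q PK PQ PU PI.
  have [n1 n2] := @moment_valuation R K Q PK PQ PU PI.
  rewrite /nu /=; split.
    rewrite -[RHS]opprK; have := congr1 (fun x => k * x) n1; rewrite /= !mulrDr; lra.
  have := congr1 (fun x => k * x) n2; rewrite /= !mulrDr; lra.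
have nu_cov : covariant nu.
  move=> a b c d P dE PP; rewrite /nu mu_cov// moment_covariant//.
  by apply: pt_eq => /=; ring.
have CE p q r : cap_val nu p q r = cap_val mu p q r - (k * (cap_val (@moment R) p q r).1, k * (cap_val (@moment R) p q r).2).
  by rewrite /cap_val /nu; apply: pt_eq => /=; ring.
have nu0 : forall t : R, 0 < t -> cap_val nu (1, 0) (0, 1) (- t, 1) = 0.
  move=> t t0; rewrite CE Fmu// Fm// /k; apply: pt_eq => /=; field; rewrite gt_eqF//.
move=> P PP; have := mu_eq0 nu_val nu_cov (C_eq0 nu_val nu_cov nu0) PP.
by rewrite /nu => /eqP; rewrite subr_eq0 => /eqP.
Qed.
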